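(* Let $\alpha>1$ and $\mu=E\{X_1\}$. Let $s=\lfloor p(t)N(t)\rfloor\to\infty$ for a function $p(t)$ with $p(t)\to0$ and $tp(t)\to\infty$ as $t\to\infty$. Then, as $t\to\infty$, $$\left(\frac{\Lambda_s(t)}{t\,p(t)\,U(p^{-1}(t))},\frac{X^*_{N(t)-s}}{U(p^{-1}(t))},\frac{\Sigma_s(t)}{t}\right)\overset{D}{\to}(\Lambda,\Xi,\Sigma),$$ where the limit has the joint Laplace transform $$E\left\{\exp(-u\Lambda-v\Xi-w\Sigma)\right\}=e^{-v}\,q_0\left(\frac{u}{1-\gamma}+w\mu\right).$$ If $\Theta=1$ a.s., $$E\left\{\exp(-u\Lambda-v\Xi-w\Sigma)\right\}=e^{-u/(1-\gamma)}e^{-v}e^{-w\mu}.$$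
   Context: Let $X_1,X_2,\ldots$ be independent positive random variables (claims) with common distribution function $F$ satisfying $1-F(x)=x^{-\alpha}\ell(x)$, $x>0$, with $\alpha>0$ and $\ell$ slowly varying at infinity. Put $\gamma=1/\alpha$ and $U(y)=F^{\leftarrow}(1-1/y)$, where $F^{\leftarrow}$ is the generalized inverse of $F$. Here $p^{-1}(t)=1/p(t)$. Let $N(t)$ be the number of claims up to time $t$, where $(N(t))_{t\ge0}$ is independent of $(X_i)_{i\ge1}$ and is near mixed Poisson: $N(t)/t\overset{D}{\to}\Theta$ as $t\to\infty$ for some random variable $\Theta$. Let $q_0(w)=E\{e^{-w\Theta}\}$. For given $N(t)=n$, $X_1^*\le\cdots\le X_n^*$ are the order statistics of $X_1,\ldots,X_n$, and $X_r^*=0$ for $r\le 0$. Set $$\Sigma_s(t)=\sum_{j=1}^{N(t)-s-1}X_j^*,\qquad \Lambda_s(t)=\sum_{j=N(t)-s+1}^{N(t)}X_j^*,$$ where empty sums are $0$; here $s$ depends on $t$ and on $N(t)$. $\overset{D}{\to}$ is convergence in distribution. *)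

(* Defs.v *)
From HB Require Import structures.
From mathcomp Require Import all_boot all_order all_algebra.
From mathcomp Require Import all_classical all_reals all_analysis.
From mathcomp Require Import finmap.

Set Implicit Arguments.
Unset Strict Implicit.
Unset Printing Implicit Defensive.

Import Order.TTheory GRing.Theory Num.Theory.
Import numFieldNormedType.Exports.

Local Open Scope classical_set_scope.
Local Open Scope ring_scope.

(* Positivity and the value of l matter only far out, so l may be arbitrary on
   the nonpositive half-line. *)
Definition slowly_varying (R : realType) (l : R -> R) : Prop :=
  [/\ measurable_fun (`]0, +oo[ : set R) l,
      (\forall x \near +oo, 0 < l x) &
      forall a : R, 0 < a -> l (a * x) / l x @[x --> +oo] --> (1 : R)].

(* F^<-(q) = inf {x | q <= F x}; only used for 0 < q < 1, where the set is
   nonempty and bounded below as soon as F is a distribution function. *)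
Definition generalized_inverse (R : realType) (F : R -> R) (q : R) : R :=
  inf [set x | q <= F x].

Definition tail_quantile (R : realType) (F : R -> R) (y : R) : R :=
  generalized_inverse F (1 - y^-1).

Definition sigma_algebra_of_family d (T : measurableType d) d'
    (T' : measurableType d') (I : Type) (D : set I) (Y : I -> T -> T') :
    set (set T) :=
  <<s \bigcup_(i in D) preimage_set_system setT (Y i) measurable >>.

Definition independent_sigma_algebras d (T : measurableType d) (R : realType)
    (P : probability T R) (G H : set (set T)) : Prop :=
  forall A B, G A -> H B -> P (A `&` B) = (P A * P B)%E.

Definition mutually_independent d (T : measurableType d) (R : realType)
    (P : probability T R) (X : nat -> T -> R) : Prop :=
  forall (J : {fset nat}) (A : nat -> set R),
    (forall j, j \in J -> measurable (A j)) ->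
    P (\bigcap_(j in [set` J]) (X j @^-1` A j)) =
    (\prod_(j <- J) P (X j @^-1` A j))%E.

(* Convergence in distribution of Y t to Z as t --> +oo; Y t and Z may live on
   different probability spaces. *)
Definition cvg_in_distribution (R : realType) (E : topologicalType)
    d (T : measurableType d) (P : probability T R) (Y : R -> T -> E)
    d' (T' : measurableType d') (Q : probability T' R) (Z : T' -> E) : Prop :=
  forall f : E -> R, continuous f -> (exists M : R, forall x, `|f x| <= M) ->
    ('E_P[f \o Y t])%E @[t --> +oo] --> ('E_Q[f \o Z])%E.

Definition diverges_in_probability (R : realType) d (T : measurableType d)
    (P : probability T R) (Y : R -> T -> nat) : Prop :=
  forall K : nat, P [set z | (Y t z < K)%N] @[t --> +oo] --> 0%E.

Definition laplace_transform (R : realType) d (T : measurableType d)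
    (P : probability T R) (Y : T -> R) (w : R) : \bar R :=
  ('E_P[fun z => expR (- (w * Y z))])%E.

Definition joint_laplace_transform (R : realType) d (T : measurableType d)
    (P : probability T R) (Y1 Y2 Y3 : T -> R) (u v w : R) : \bar R :=
  ('E_P[fun z => expR (- (u * Y1 z) - v * Y2 z - w * Y3 z)])%E.

(* X_r^* among the n values x 0, ..., x n.-1, in nondecreasing order, for
   1 <= r <= n. An index r <= 0 becomes 0 through truncated subtraction on nat,
   whence the value 0 there. *)
Definition order_stat (R : realType) (x : nat -> R) (n r : nat) : R :=
  if r is r'.+1 then nth 0 (sort <=%R (mkseq x n)) r' else 0.

Definition smallest_sum (R : realType) (x : nat -> R) (n s : nat) : R :=
  \sum_(1 <= j < (n - s - 1).+1) order_stat x n j.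

Definition largest_sum (R : realType) (x : nat -> R) (n s : nat) : R :=
  \sum_((n - s).+1 <= j < n.+1) order_stat x n j.

(* Main.v *)
Require Import Defs.
From HB Require Import structures.
From mathcomp Require Import all_boot all_order all_algebra.
From mathcomp Require Import finmap.
From mathcomp Require Import all_classical all_reals all_analysis.
From mathcomp Require Import measurable_realfun.
From mathcomp Require Import ring lra zify.

Set Implicit Arguments.
Unset Strict Implicit.
Unset Printing Implicit Defensive.

Import Order.TTheory GRing.Theory Num.Theory.
Import numFieldNormedType.Exports.

Local Open Scope classical_set_scope.
Local Open Scope ring_scope.

(** The limit is (Theta/(1-gamma), 1, mu Theta).  Given N(t) = n, which by
   independence may be treated as fixed, put W = U(1/p(t)) and
   tau = 1 - F.  The number of claims above a W concentrates around
   n tau(a W) ~ n p a^(-alpha); taking a slightly above and below 1 locates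
   X*_(n-s) near W.  Moreover s y + sum_i (X_i - y)^+ bounds Lambda_s from above
   for every y, with equality at y = X*_(n-s), so that a law of large numbers for
   the excesses and Karamata's theorem E(X - y)^+ ~ y tau(y)/(alpha - 1) give
   Lambda_s ~ n p W alpha/(alpha - 1), and Sigma_s/n -> mu follows by
   subtraction.  All errors are relative to N(t)/t, which is tight, so the triple
   stays close to the image of N(t)/t under theta |-> (theta/(1-gamma), 1,
   mu theta). *)

(** * Order statistics *)

(** For 1 < alpha <= 2 the claims may have infinite variance, and order statistics are not sums of
    independent terms. Hence the probabilistic work is confined to five sums over a sample of fixed
    size: two counts of exceedances and three sums of excesses. Once these are near their means, the
    three statistics are located by a deterministic argument ([typical_sample_order_stats]). Since
    the sample size is random, the probability bounds must be uniform in [n]: they hold for all [n]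
    with [K <= p t * n%:R], where [K] does not depend on [t]. As Theta may vanish with positive
    probability, convergence of N(t)/t alone does not put N(t) in this range; divergence of [s]
    does. The exceptional event for each [n] lies in the sigma-algebra of the claims, so it is
    independent of the event N(t) = n, and the cases are summed over [n]. *)

Lemma sum_sort (R : realType) (x : nat -> R) (n : nat) (phi : R -> R) :
  \sum_(i < n) phi (x i) =
  \sum_(0 <= j < n) phi (nth 0 (sort <=%R (mkseq x n)) j).
Proof.
transitivity (\sum_(y <- mkseq x n) phi y).
  by rewrite -(big_mkord xpredT (phi \o x)) /index_iota subn0 big_map.
rewrite -(perm_big _ (permEl (perm_sort <=%R (mkseq x n)))).
by rewrite (big_nth 0) size_sort size_mkseq.
Qed.

Lemma nth_sort_le (R : realType) (x : nat -> R) (n i j : nat) :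
  (i <= j)%N -> (j < n)%N ->
  nth 0 (sort <=%R (mkseq x n)) i <= nth 0 (sort <=%R (mkseq x n)) j.
Proof.
move=> ij jn; have sz : size (sort <=%R (mkseq x n)) = n.
  by rewrite size_sort size_mkseq.
apply: (sorted_leq_nth le_trans lexx) => //; first exact/sort_sorted/le_total.
- by rewrite inE sz (leq_ltn_trans ij).
- by rewrite inE sz.
Qed.

Lemma largest_sumE (R : realType) (x : nat -> R) (n s : nat) :
  largest_sum x n s =
  \sum_(n - s <= j < n) nth 0 (sort <=%R (mkseq x n)) j.
Proof. by rewrite /largest_sum big_add1. Qed.

Lemma smallest_sumE (R : realType) (x : nat -> R) (n s : nat) :
  smallest_sum x n s =
  \sum_(0 <= j < n - s - 1) nth 0 (sort <=%R (mkseq x n)) j.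
Proof. by rewrite /smallest_sum big_add1. Qed.

Lemma order_statE (R : realType) (x : nat -> R) (n s : nat) : (s < n)%N ->
  order_stat x n (n - s) = nth 0 (sort <=%R (mkseq x n)) (n - s - 1).
Proof. by rewrite -subn_gt0; case: (n - s)%N => // k _; rewrite subn1. Qed.

Lemma sum_order_stats (R : realType) (x : nat -> R) (n s : nat) : (s < n)%N ->
  smallest_sum x n s + order_stat x n (n - s) + largest_sum x n s =
  \sum_(i < n) x i.
Proof.
move=> sn; rewrite (sum_sort x n id) smallest_sumE largest_sumE order_statE//.
have e : (n - s = (n - s - 1).+1)%N by rewrite subn1 prednK// subn_gt0.
rewrite [RHS](big_cat_nat (n := (n - s)%N))//=; last exact: leq_subr.
by rewrite [in X in _ = X + _]e big_nat_recr.
Qed.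

(** Were X*_(n-s) above [y], the [s.+1] entries from its position upward would all exceed [y]. *)
Lemma order_stat_le (R : realType) (x : nat -> R) (n s : nat) (y : R) :
  (s < n)%N -> \sum_(i < n) (y < x i)%R%:R <= s%:R :> R ->
  order_stat x n (n - s) <= y.
Proof.
move=> sn; rewrite order_statE// (sum_sort x n (fun a => (y < a)%R%:R)).
apply: contraTT; rewrite -!ltNge => yl.
rewrite (big_cat_nat (n := (n - s - 1)%N))//=; last first.
  by rewrite (leq_trans (leq_subr _ _)) ?leq_subr.
rewrite ltr_wpDl ?sumr_ge0//.
have -> : \sum_(n - s - 1 <= j < n)
    (y < nth 0 (sort <=%R (mkseq x n)) j)%R%:R = \sum_(n - s - 1 <= j < n) (1 : R).
  rewrite !big_nat; apply: eq_bigr => j /andP[j1 j2].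
  by rewrite (lt_le_trans yl (nth_sort_le _ _ _)).
rewrite sumr_const_nat ltr_nat -subnDA subKn; first by rewrite addn1.
by rewrite addn1.
Qed.

(** Were X*_(n-s) at most [y], so would be the [n - s] entries up to it, which leaves at most [s]
    entries above [y]. *)
Lemma order_stat_gt (R : realType) (x : nat -> R) (n s : nat) (y : R) :
  (s < n)%N -> s%:R < \sum_(i < n) (y < x i)%R%:R :> R ->
  y < order_stat x n (n - s).
Proof.
move=> sn; rewrite order_statE// (sum_sort x n (fun a => (y < a)%R%:R)).
apply: contraTT; rewrite -!leNgt => yl.
have e : (n - s = (n - s - 1).+1)%N by rewrite subn1 prednK// subn_gt0.
rewrite (big_cat_nat (n := (n - s)%N))//=; last exact: leq_subr.
rewrite [X in X + _]big_nat big1; last first.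
  move=> j /andP[_ jns]; rewrite ltNge (le_trans (nth_sort_le _ _ _) yl)//.
    by rewrite -ltnS -e.
  by lia.
rewrite add0r (@le_trans _ _ (\sum_(n - s <= j < n) (1 : R)))//.
  by apply: ler_sum => j _; case: (_ < _)%R.
by rewrite sumr_const_nat subKn// ltnW.
Qed.

(* The bound holds for every y, with equality at y = X*_(n-s). *)
Lemma largest_sum_le (R : realType) (x : nat -> R) (n s : nat) (y : R) :
  (s < n)%N ->
  largest_sum x n s <= s%:R * y + \sum_(i < n) Num.max 0 (x i - y).
Proof.
move=> sn; rewrite (sum_sort x n (fun a => Num.max 0 (a - y))) largest_sumE.
rewrite [in leRHS](big_cat_nat (n := (n - s)%N))//=; last exact: leq_subr.
rewrite addrCA ler_wpDl//; first by apply: sumr_ge0 => i _; rewrite le_max lexx.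
have -> : s%:R * y = \sum_(n - s <= j < n) y.
  by rewrite sumr_const_nat subKn 1?ltnW// mulr_natl.
rewrite -big_split/=; apply: ler_sum => j _.
by rewrite -lerBlDl le_max lexx orbT.
Qed.

(** Two levels, because X*_(n-s) will be known only up to an interval. Each of the [s] largest
    entries is at least [a]; if it exceeds [y], it is [y] plus its excess, and [a <= y]. The other
    entries have no excess over [y]. *)
Lemma largest_sum_ge (R : realType) (x : nat -> R) (n s : nat) (a y : R) :
  (s < n)%N -> a <= order_stat x n (n - s) <= y ->
  s%:R * a + \sum_(i < n) Num.max 0 (x i - y) <= largest_sum x n s.
Proof.
move=> sn; rewrite order_statE// => /andP[al ly].
have e : (n - s = (n - s - 1).+1)%N by rewrite subn1 prednK// subn_gt0.
rewrite (sum_sort x n (fun b => Num.max 0 (b - y))) largest_sumE.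
rewrite [in leLHS](big_cat_nat (n := (n - s)%N))//=; last exact: leq_subr.
rewrite [X in _ + (X + _)]big_nat big1 ?add0r; last first.
  move=> j /andP[_ jns]; apply/max_idPl; rewrite subr_le0.
  by rewrite (le_trans (nth_sort_le _ _ _) ly)//; lia.
have -> : s%:R * a = \sum_(n - s <= j < n) a.
  by rewrite sumr_const_nat subKn 1?ltnW// mulr_natl.
rewrite -big_split/= !big_nat; apply: ler_sum => j /andP[j1 j2].
have lj : nth 0 (sort <=%R (mkseq x n)) (n - s - 1) <=
          nth 0 (sort <=%R (mkseq x n)) j by apply: nth_sort_le => //; lia.
rewrite -lerBrDl ge_max subr_ge0 (le_trans al lj)/= lerD2l lerN2.
exact: le_trans al ly.
Qed.

(** * Mean excess and Karamata's theorem *)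

(** Extended-real valued, since finiteness is a consequence of the tail behaviour
    ([mean_excess_fin_num]). *)
Definition mean_excess (R : realType) d (T : measurableType d)
    (P : probability T R) (X : T -> R) (y : R) : \bar R :=
  (\int[P]_z (Num.max 0 (X z - y))%:E)%E.

Lemma measurable_excess d (T : measurableType d) (R : realType) (X : T -> R)
    (y : R) : measurable_fun setT X ->
  measurable_fun setT (fun z => Num.max 0 (X z - y)).
Proof.
move=> mX; apply: measurable_maxr => //; exact: measurable_funB.
Qed.

Lemma measurable_gt d (T : measurableType d) (R : realType) (X : T -> R)
    (a : R) : measurable_fun setT X -> measurable [set z | a < X z].
Proof.
move=> mX; rewrite -[X in measurable X]setTI.
exact: (measurable_fun_ltr (measurable_cst a) mX measurableT (Y := [set true])).
Qed.

Lemma indic_gt (T : Type) (R : realType) (X : T -> R) (a : R) :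
  (fun z => (a < X z)%R%:R : R) = \1_[set z | a < X z].
Proof.
apply/funext => z; rewrite indicE; congr (nat_of_bool _)%:R.
by apply/idP/idP => [/mem_set//|/set_mem].
Qed.

Lemma measurable_gt_nat d (T : measurableType d) (R : realType) (X : T -> R)
    (a : R) : measurable_fun setT X ->
  measurable_fun setT (fun z => (a < X z)%R%:R : R).
Proof.
by move=> mX; rewrite indic_gt; exact/measurable_indic/measurable_gt.
Qed.

Lemma integral_gt_nat d (T : measurableType d) (R : realType)
    (P : probability T R) (X : T -> R) (a c : R) : measurable_fun setT X ->
  0 <= c ->
  (\int[P]_z (c * (a < X z)%R%:R)%:E = c%:E * P [set z | (a < X z)%R])%E.
Proof.
move=> mX c0; have mA : measurable [set z | a < X z].
  exact: measurable_gt.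
under eq_integral do rewrite EFinM.
rewrite ge0_integralZl_EFin//; last first.
  exact/measurable_EFinP/measurable_gt_nat.
by rewrite -[X in P X]setTI setIC -integral_indic// -indic_gt.
Qed.

(** (x - y)^+ is the integral over r > y of the indicator of r < x. The sums are its lower and upper
    Riemann sums on the grid [u]; taking expectations turns the indicators into tail values. *)
Lemma excess_telescope (R : realType) (x y : R) (u : nat -> R) (n : nat) :
  u 0%N = y -> (forall k, u k <= u k.+1) ->
  \sum_(0 <= k < n) (u k.+1 - u k) * (u k.+1 < x)%R%:R <= Num.max 0 (x - y) /\
  (x <= u n ->
   Num.max 0 (x - y) <= \sum_(0 <= k < n) (u k.+1 - u k) * (u k < x)%R%:R).
Proof.
(* [m k] is the part of the excess lying below [u k]; its increments are the lengths of the parts of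
   the grid cells below [x]. *)
move=> u0 uS; pose m k := Num.max 0 (Num.min x (u k) - y).
have yu k : y <= u k by elim: k => [|k ih]; rewrite ?u0// (le_trans ih).
have m0 : m 0%N = 0.
  by apply/max_idPl; rewrite u0 subr_le0 ge_min lexx orbT.
have step k : (u k.+1 - u k) * (u k.+1 < x)%R%:R <= m k.+1 - m k <=
              (u k.+1 - u k) * (u k < x)%R%:R.
  rewrite /m; move: (uS k) (yu k) (yu k.+1) => ? ? ?.
  have [|] := ltP (u k.+1) x; have [|] := ltP (u k) x => ? ?;
    rewrite ?mulr0 ?mulr1.
  - by rewrite !max_r ?subr_ge0//; apply/andP; split; lra.
  - by lra.
  - rewrite (@max_r _ _ 0 (u k - y)) ?subr_ge0//.
    have -> : Num.max 0 (x - y) = x - y by apply: max_r; lra.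
    by apply/andP; split; lra.
  - by rewrite subrr lexx.
have tel : m n = \sum_(0 <= k < n) (m k.+1 - m k).
  by rewrite telescope_sumr// m0 subr0.
split=> [|xn].
  apply: (@le_trans _ _ (m n)).
    by rewrite tel; apply: ler_sum => k _; case/andP: (step k).
  by rewrite /m le_max2// lerB// ge_min lexx.
have -> : Num.max 0 (x - y) = m n by rewrite /m min_l.
by rewrite tel; apply: ler_sum => k _; case/andP: (step k).
Qed.

Lemma mean_excess_ge_sum d (T : measurableType d) (R : realType)
    (P : probability T R) (X : {RV P >-> R}) (tau : R -> R) (v : nat -> R)
    (n : nat) (y : R) :
  (forall a, P [set z | a < X z] = (tau a)%:E) ->
  v 0%N = y -> (forall k, v k <= v k.+1) ->
  ((\sum_(0 <= k < n) (v k.+1 - v k) * tau (v k.+1))%:E <=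
   mean_excess P X y)%E.
Proof.
move=> tauE v0 vS.
have -> : (\sum_(0 <= k < n) (v k.+1 - v k) * tau (v k.+1))%:E =
   (\int[P]_z (\sum_(0 <= k < n)
      ((v k.+1 - v k) * (v k.+1 < X z)%R%:R)%:E))%E.
  rewrite ge0_integral_sum//=.
  - rewrite -sumEFin; apply: eq_bigr => k _.
    by rewrite integral_gt_nat ?subr_ge0// EFinM tauE.
  - move=> k; apply/measurable_EFinP; apply: measurable_funM => //.
    exact: measurable_gt_nat.
  - by move=> k z _; rewrite lee_fin mulr_ge0// subr_ge0.
apply: ge0_le_integral => //.
- by move=> z _; apply: sume_ge0 => k _; rewrite lee_fin mulr_ge0// subr_ge0.
- apply: emeasurable_sum => k; apply/measurable_EFinP.
  by apply: measurable_funM => //; exact: measurable_gt_nat.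
- exact/measurable_EFinP/measurable_excess.
- by move=> z _; rewrite sumEFin lee_fin; case: (excess_telescope (X z) n v0 vS).
Qed.

(** The upper Riemann sum dominates the excess only from an index [n] with [X z <= v n] on, which
    depends on [z]; hence the whole series is integrated. *)
Lemma mean_excess_le_sum d (T : measurableType d) (R : realType)
    (P : probability T R) (X : {RV P >-> R}) (tau : R -> R) (v : nat -> R)
    (y B : R) :
  (forall a, P [set z | a < X z] = (tau a)%:E) ->
  v 0%N = y -> (forall k, v k <= v k.+1) -> v @ \oo --> +oo ->
  (forall n, \sum_(0 <= k < n) (v k.+1 - v k) * tau (v k) <= B) ->
  (mean_excess P X y <= B%:E)%E.
Proof.
move=> tauE v0 vS voo vB.
have mv k : measurable_fun setT
    (fun z => ((v k.+1 - v k) * (v k < X z)%R%:R)%:E).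
  apply/measurable_EFinP; apply: measurable_funM => //.
  exact: measurable_gt_nat.
have v_ge0 k z : (0 <= ((v k.+1 - v k) * (v k < X z)%R%:R)%:E)%E.
  by rewrite lee_fin mulr_ge0// subr_ge0.
apply: (@le_trans _ _ (\int[P]_z (\sum_(0 <= k <oo)
    ((v k.+1 - v k) * (v k < X z)%R%:R)%:E))%E).
  apply: ge0_le_integral => //.
  - by move=> z _; rewrite lee_fin le_max lexx.
  - exact/measurable_EFinP/measurable_excess.
  - by apply: ge0_emeasurable_sum => // k z _ _; exact: v_ge0.
  - move=> z _.
    have [n _ /(_ n (leqnn n)) /= Xn] : \forall n \near \oo, X z <= v n.
      by move/cvgryPge : voo; exact.
    apply: (@le_trans _ _ (\sum_(0 <= k < n)
        ((v k.+1 - v k) * (v k < X z)%R%:R)%:E)%E).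
      rewrite sumEFin lee_fin.
      by case: (excess_telescope (X z) n v0 vS) => _; apply.
    by apply: nneseries_lim_ge => k _ _; exact: v_ge0.
rewrite integral_nneseries//.
apply: lime_le.
  by apply: is_cvg_nneseries => k _ _; apply: integral_ge0 => z _; exact: v_ge0.
apply: nearW => n.
apply: (@le_trans _ _ (\sum_(0 <= k < n) (v k.+1 - v k) * tau (v k))%:E);
  last by rewrite lee_fin.
rewrite -sumEFin; apply: lee_sum => k _.
by rewrite integral_gt_nat ?subr_ge0// EFinM tauE.
Qed.

Lemma tail_nonincreasing d (T : measurableType d) (R : realType)
    (P : probability T R) (X : {RV P >-> R}) (tau : R -> R) :
  (forall a, P [set z | a < X z] = (tau a)%:E) ->
  forall a b, a <= b -> tau b <= tau a.
Proof.
move=> tauE a b ab; rewrite -lee_fin -!tauE le_measure//=.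
- exact/mem_set/measurable_gt.
- exact/mem_set/measurable_gt.
- by move=> z /=; exact: le_lt_trans.
Qed.

Lemma tail_ge0 d (T : measurableType d) (R : realType)
    (P : probability T R) (X : {RV P >-> R}) (tau : R -> R) :
  (forall a, P [set z | a < X z] = (tau a)%:E) -> forall a, 0 <= tau a.
Proof. by move=> tauE a; rewrite -lee_fin -tauE. Qed.

(** On the grid [c ^+ k * y] the tail decays at least like [(q / c) ^+ k] while the cells grow like
    [c ^+ k], so the upper sums are dominated by a geometric series of ratio [q]. *)
Lemma mean_excess_le_geometric d (T : measurableType d) (R : realType)
    (P : probability T R) (X : {RV P >-> R}) (tau : R -> R) (c q y : R) :
  (forall a, P [set z | a < X z] = (tau a)%:E) ->
  1 < c -> 0 < q < 1 -> 0 < y ->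
  (forall x, y <= x -> tau (c * x) <= q / c * tau x) ->
  (mean_excess P X y <= ((c - 1) / (1 - q) * (y * tau y))%:E)%E.
Proof.
move=> tauE c1 /andP[q0 q1] y0 tauq.
have c0 : 0 < c by lra.
have cy k : y <= c ^+ k * y.
  by rewrite ler_peMl ?exprn_ege1// ltW.
have tauk k : tau (c ^+ k * y) <= (q / c) ^+ k * tau y.
  elim: k => [|k ih]; first by rewrite !expr0 !mul1r.
  rewrite exprS -mulrA (le_trans (tauq _ (cy k)))// exprS -[leRHS]mulrA.
  by rewrite ler_pM2l ?divr_gt0.
apply: (@mean_excess_le_sum _ _ _ _ _ tau (fun k => c ^+ k * y)) => //.
- by rewrite expr0 mul1r.
- move=> k; rewrite ler_pM2r// exprS ler_peMl ?exprn_ge0// ltW//.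
- apply/cvgryPge => A; near=> k.
  (* Bernoulli's inequality, which makes the grid diverge. *)
  have ck : 1 + (c - 1) *+ k <= c ^+ k.
    rewrite -[in leRHS](subrK 1 c); elim: {+}k => [|j ih].
      by rewrite mulr0n addr0 expr0.
    rewrite exprS mulrS; have : 0 <= (c - 1) *+ j by rewrite mulrn_wge0; lra.
    move: ih; set u := (c - 1) *+ j; set w := _ ^+ j => ih u0.
    have : (c - 1 + 1) * (1 + u) <= (c - 1 + 1) * w by rewrite ler_pM2l//; lra.
    by nra.
  apply: (@le_trans _ _ (((c - 1) *+ k) * y)).
    rewrite -ler_pdivrMr// -mulr_natl -ler_pdivrMr ?subr_gt0//.
    by near: k; exact: nbhs_infty_ger.
  by rewrite ler_pM2r//; lra.
- move=> n; apply: (@le_trans _ _ (\sum_(0 <= k < n) (c - 1) * (y * tau y) * q ^+ k)).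
    apply: ler_sum => k _.
    have -> : (c - 1) * (y * tau y) * q ^+ k =
        (c ^+ k.+1 * y - c ^+ k * y) * ((q / c) ^+ k * tau y).
      rewrite expr_div_n exprS; field.
      by rewrite expf_neq0// gt_eqF.
    rewrite ler_wpM2l// subr_ge0 ler_pM2r// exprS ler_peMl ?exprn_ge0// ltW//.
  have aux : 0 <= (c - 1) * (y * tau y).
    have ty : 0 <= tau y by exact: tail_ge0 tauE y.
    by rewrite mulr_ge0 ?(mulr_ge0 _ ty) ?subr_ge0 ?(ltW c1) ?(ltW y0).
  have := @geometric_le_lim R n _ q aux q0.
  by rewrite gtr0_norm// [leRHS]mulrAC; exact.
Unshelve. all: by end_near. Qed.

Lemma mean_excess_ge_geometric d (T : measurableType d) (R : realType)
    (P : probability T R) (X : {RV P >-> R}) (tau : R -> R) (c q y : R) :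
  (forall a, P [set z | a < X z] = (tau a)%:E) ->
  1 < c -> 0 < q < 1 -> 0 < y ->
  (forall x, y <= x -> q / c * tau x <= tau (c * x)) ->
  (((1 - c^-1) * q / (1 - q) * (y * tau y))%:E <= mean_excess P X y)%E.
Proof.
move=> tauE c1 /andP[q0 q1] y0 tauq.
have c0 : 0 < c by lra.
have cy k : y <= c ^+ k * y.
  by rewrite ler_peMl ?exprn_ege1// ltW.
have tauk k : (q / c) ^+ k * tau y <= tau (c ^+ k * y).
  elim: k => [|k ih]; first by rewrite !expr0 !mul1r.
  rewrite [c ^+ _]exprS -mulrA (le_trans _ (tauq _ (cy k)))//.
  rewrite exprS -[leLHS]mulrA.
  by rewrite ler_pM2l ?divr_gt0.
(* The lower sum takes the tail at the right end of each cell, so that a factor [q / c] is present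
   already at [k = 0]. *)
set a := (1 - c^-1) * q * (y * tau y).
have H n : ((a * (1 - q ^+ n) / (1 - q))%:E <= mean_excess P X y)%E.
  apply: (@le_trans _ _ (\sum_(0 <= k < n)
      (c ^+ k.+1 * y - c ^+ k * y) * tau (c ^+ k.+1 * y))%:E); last first.
    apply: (@mean_excess_ge_sum _ _ _ _ _ tau (fun k => c ^+ k * y)) => //.
      by rewrite expr0 mul1r.
    by move=> k; rewrite ler_pM2r// exprS ler_peMl ?exprn_ge0// ltW.
  have := @geometric_seriesE R a q; rewrite lt_eqF// => /(_ isT).
  move=> /(congr1 (fun f => f n)) /= <-; rewrite lee_fin.
  apply: ler_sum => k _; rewrite /geometric/=.
  have -> : a * q ^+ k =
      (c ^+ k.+1 * y - c ^+ k * y) * ((q / c) ^+ k.+1 * tau y).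
    rewrite /a expr_div_n !exprS; field.
    by rewrite !(expf_neq0, gt_eqF c0).
  rewrite ler_wpM2l// subr_ge0 ler_pM2r// exprS ler_peMl ?exprn_ge0// ltW//.
have -> : (1 - c^-1) * q / (1 - q) * (y * tau y) = a / (1 - q).
  by rewrite /a; ring.
have HL : (a * (1 - q ^+ n) / (1 - q))%:E @[n --> \oo] --> (a / (1 - q))%:E.
  apply: cvg_EFin; first exact: nearW.
  apply: cvgMl; rewrite -[X in _ --> X]mulr1; apply: cvgMr.
  rewrite -[X in _ --> X]subr0; apply: cvgB; first exact: cvg_cst.
  have := @cvg_geometric R 1 q; rewrite gtr0_norm// => /(_ q1).
  by rewrite /geometric/=; under [X in X @ _ --> _]funext do rewrite mul1r.
rewrite -(cvg_lim _ HL)//; apply: lime_le; last exact: nearW.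
by apply/cvg_ex; exists (a / (1 - q))%:E.
Qed.

(** Here [b] is alpha - 1. As c decreases to 1, both (c - 1) / (1 - c^(-b)) and (1 - 1/c) c^(-b) /
    (1 - c^(-b)) tend to 1/b. [q1] and [q2] lie strictly on either side of c^(-b) because tau(c
    x)/tau(x) only approaches c^(-alpha). *)
Lemma geometric_grid (R : realType) (b eps : R) : 0 < b -> 0 < eps ->
  exists c q1 q2 : R,
    [/\ 1 < c, 0 < q1, q1 < c `^ (- b), c `^ (- b) < q2 & q2 < 1] /\
    (c - 1) / (1 - q2) <= b^-1 + eps /\
    b^-1 - eps <= (1 - c^-1) * q1 / (1 - q1).
Proof.
move=> b0 eps0; have bi0 : 0 < b^-1 by rewrite invr_gt0.
have bb : b * b^-1 = 1 by rewrite mulfV// gt_eqF.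
have [h [h0 h4 hb he]] : exists h, [/\ 0 < h, 4 * h <= 1, 4 * b * h <= 1 &
    4 * b * h + 2 * h <= b * eps].
  pose D := 4 * b + 2.
  have D0 : 0 < D by rewrite /D; lra.
  exists (Num.min 4^-1 (Num.min (4 * b)^-1 (b * eps / D))); split.
  - by rewrite !lt_min !invr_gt0 divr_gt0 ?mulr_gt0// ?ltr0n.
  - by rewrite mulrC -ler_pdivlMr ?ltr0n// ge_min mul1r lexx.
  - by rewrite mulrC -ler_pdivlMr ?mulr_gt0 ?ltr0n// !ge_min mul1r lexx orbT.
  - rewrite -mulrDl mulrC -ler_pdivlMr//.
    by rewrite !ge_min lexx !orbT.
have bh0 : 0 < b * h by rewrite mulr_gt0.
set c := expR h.
have c0 : 0 < c by exact: expR_gt0.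
have c1 : 1 < c by rewrite expR_gt1.
have cV : c * c^-1 = 1 by rewrite mulfV// gt_eqF.
have ci0 : 0 < c^-1 by rewrite invr_gt0.
have cVge : 1 - h <= c^-1 by rewrite -expRN; exact: expR_ge1Dx.
have cge : 1 + h <= c by exact: expR_ge1Dx.
have cle : c - 1 <= h * (1 + 2 * h).
  have : c * (1 - h) <= 1 by rewrite -[leRHS]cV ler_pM2l.
  have h1 : 0 < 1 - h by lra.
  have : 0 <= h * h * (1 - 2 * h) by rewrite !mulr_ge0 ?(ltW h0)//; lra.
  by move=> ? ?; rewrite -(ler_pM2r h1); nra.
have cVle : c^-1 * (1 + h) <= 1 by rewrite -[leRHS]cV mulrC ler_pM2r.
set e := expR (b * h).
have e0 : 0 < e by exact: expR_gt0.
have ege : 1 + b * h <= e by exact: expR_ge1Dx.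
have eVge : 1 - b * h <= e^-1 by rewrite -expRN; exact: expR_ge1Dx.
have cbE : c `^ (- b) = e^-1 by rewrite /c -expRM mulrN expRN mulrC.
(* From 1 - b h <= exp(-b h) <= 1 / (1 + b h), moved apart to make the inequalities strict while 1 -
   q stays b h (1 + O(h)). *)
exists c, (1 - b * h * (1 + h)), (1 - b * h / (1 + 2 * (b * h))).
rewrite cbE.
have d0 : 0 < 1 + 2 * (b * h) by lra.
split; [split|split].
- by [].
- by nra.
- by apply: lt_le_trans eVge; nra.
- have -> : 1 - b * h / (1 + 2 * (b * h)) = (1 + b * h) / (1 + 2 * (b * h)).
    by field; rewrite gt_eqF.
  rewrite ltr_pdivlMr// mulrC ltr_pdivrMr//.
  apply: (@lt_le_trans _ _ ((1 + b * h) * (1 + b * h))); first by nra.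
  by rewrite ler_pM2l//; lra.
- by rewrite ltrBlDr ltrDl divr_gt0.
- rewrite subKr invf_div [leLHS]mulrA ler_pdivrMr//.
  apply: (@le_trans _ _ (h * (1 + 2 * h) * (1 + 2 * (b * h)))).
    by rewrite ler_pM2r.
  have -> : (b^-1 + eps) * (b * h) = h * (b * b^-1) + h * (b * eps) by ring.
  rewrite bb mulr1 -mulrA -[X in _ <= X + _]mulr1 -mulrDr ler_pM2l//.
  by nra.
- have k0 : 0 < b * h * (1 + h) by rewrite mulr_gt0//; lra.
  rewrite subKr ler_pdivlMr//.
  have -> : (b^-1 - eps) * (b * h * (1 + h)) =
            h * (1 + h) * (b * b^-1 - b * eps) by ring.
  rewrite bb.
  have cVge' : h <= (1 - c^-1) * (1 + h) by nra.
  have q0 : 0 <= 1 - b * h * (1 + h) by nra.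
  have h1 : 0 < 1 + h by lra.
  rewrite -(ler_pM2r h1) [leRHS]mulrAC.
  apply: (@le_trans _ _ (h * (1 - b * h * (1 + h)))); last by rewrite ler_wpM2r.
  rewrite -!mulrA ler_pM2l//.
  apply: (@le_trans _ _ ((1 + h) * ((1 - (4 * b * h + 2 * h)) * (1 + h)))).
    by rewrite ler_pM2l// ler_pM2r//; lra.
  have := mulr_gt0 h0 h0; have := mulr_gt0 (mulr_gt0 h0 h0) h0.
  have := mulr_gt0 (mulr_gt0 h0 h0) bh0; have := mulr_gt0 h0 bh0.
  by nra.
Qed.

(* Karamata's theorem, obtained by comparing E(X - y)^+ with the sums of
   (c^(k+1) - c^k) y tau(c^k y) and (c^(k+1) - c^k) y tau(c^(k+1) y). *)
Lemma mean_excess_near d (T : measurableType d) (R : realType)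
    (P : probability T R) (X : {RV P >-> R}) (tau : R -> R) (alpha eps : R) :
  (forall a, P [set z | a < X z] = (tau a)%:E) -> (forall a, 0 < tau a) ->
  1 < alpha ->
  (forall a, 0 < a -> tau (a * x) / tau x @[x --> +oo] --> a `^ (- alpha)) ->
  0 < eps ->
  \forall y \near +oo, [/\ 0 < y,
    ((((alpha - 1)^-1 - eps) * (y * tau y))%:E <= mean_excess P X y)%E &
    (mean_excess P X y <= (((alpha - 1)^-1 + eps) * (y * tau y))%:E)%E].
Proof.
move=> tauE tau0 a1 tauRV eps0.
have b0 : 0 < alpha - 1 by rewrite subr_gt0.
have [c [q1 [q2 [[c1 q10 q1c cq2 q21] [up lo]]]]] := geometric_grid b0 eps0.
have c0 : 0 < c by lra.
have ca : c `^ (- alpha) = c `^ (- (alpha - 1)) / c.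
  have -> : - alpha = - (alpha - 1) + - 1 by ring.
  by rewrite powRD ?(gt_eqF c0) ?implybT// powR_inv1// ltW.
have q1a : q1 / c < c `^ (- alpha) by rewrite ca ltr_pM2r ?invr_gt0.
have q2a : c `^ (- alpha) < q2 / c by rewrite ca ltr_pM2r ?invr_gt0.
have q1q2 : q1 < q2 by exact: lt_trans cq2.
have [x1 [_ x1P]] : \forall x \near +oo, q1 / c < tau (c * x) / tau x.
  exact: (cvgr_gt _ (tauRV _ c0)).
have [x2 [_ x2P]] : \forall x \near +oo, tau (c * x) / tau x < q2 / c.
  exact: (cvgr_lt _ (tauRV _ c0)).
near=> y.
have y0 : 0 < y by near: y; exact/nbhs_pinfty_gt/num_real.
have yt0 : 0 < y * tau y by rewrite mulr_gt0.
split=> //.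
- apply: le_trans (mean_excess_ge_geometric tauE c1 (q := q1) _ y0 _).
  + by rewrite lee_fin ler_pM2r.
  + by rewrite q10 (lt_trans q1q2).
  + move=> x yx; rewrite -ler_pdivlMr// ltW// x1P// (lt_le_trans _ yx)//.
    by near: y; exact/nbhs_pinfty_gt/num_real.
- apply: le_trans (mean_excess_le_geometric tauE c1 (q := q2) _ y0 _) _.
  + by rewrite q21 (lt_trans q10).
  + move=> x yx; rewrite -ler_pdivrMr// ltW// x2P// (lt_le_trans _ yx)//.
    by near: y; exact/nbhs_pinfty_gt/num_real.
  + by rewrite lee_fin ler_pM2r.
Unshelve. all: by end_near. Qed.

Lemma mean_excess_ge0 d (T : measurableType d) (R : realType)
    (P : probability T R) (X : T -> R) (y : R) : (0 <= mean_excess P X y)%E.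
Proof. by apply: integral_ge0 => z _; rewrite lee_fin le_max lexx. Qed.

Lemma mean_excess_nonincreasing d (T : measurableType d) (R : realType)
    (P : probability T R) (X : {RV P >-> R}) (x y : R) :
  x <= y -> (mean_excess P X y <= mean_excess P X x)%E.
Proof.
move=> xy; apply: ge0_le_integral => //.
- by move=> z _; rewrite lee_fin le_max lexx.
- exact/measurable_EFinP/measurable_excess.
- exact/measurable_EFinP/measurable_excess.
- by move=> z _; rewrite lee_fin le_max2// lerB.
Qed.

Lemma mean_excess_leD d (T : measurableType d) (R : realType)
    (P : probability T R) (X : {RV P >-> R}) (x y : R) :
  x <= y -> (mean_excess P X x <= (y - x)%:E + mean_excess P X y)%E.
Proof.
move=> xy; have -> : ((y - x)%:E = \int[P]_z (y - x)%:E)%E.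
  by rewrite integral_cst//= probability_setT mule1.
rewrite -ge0_integralD//.
- apply: ge0_le_integral => //.
  + by move=> z _; rewrite lee_fin le_max lexx.
  + exact/measurable_EFinP/measurable_excess.
  + apply: emeasurable_funD => //.
    exact/measurable_EFinP/measurable_excess.
  + move=> z _; rewrite lee_fin ge_max; apply/andP; split.
      by rewrite addr_ge0 ?subr_ge0// le_max lexx.
    by rewrite -lerBlDl le_max; apply/orP; right; lra.
- by move=> z _; rewrite lee_fin subr_ge0.
- by move=> z _; rewrite lee_fin le_max lexx.
- exact/measurable_EFinP/measurable_excess.
Qed.

(** Karamata's upper bound gives finiteness at a far threshold [y0], and lowering the threshold to
    [y] adds at most [y0 - y]. *)
Lemma mean_excess_fin_num d (T : measurableType d) (R : realType)
    (P : probability T R) (X : {RV P >-> R}) (tau : R -> R) (alpha : R) :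
  (forall a, P [set z | a < X z] = (tau a)%:E) -> (forall a, 0 < tau a) ->
  1 < alpha ->
  (forall a, 0 < a -> tau (a * x) / tau x @[x --> +oo] --> a `^ (- alpha)) ->
  forall y, mean_excess P X y \is a fin_num.
Proof.
move=> tauE tau0 a1 tauRV y.
have [y0 [yy0 _ up]] : exists y0, [/\ y <= y0, 0 < y0 &
    (mean_excess P X y0 <= (((alpha - 1)^-1 + 1) * (y0 * tau y0))%:E)%E].
  have [x [_ H]] := mean_excess_near tauE tau0 a1 tauRV (@ltr01 R).
  pose y0 := Num.max y (x + 1); exists y0.
  have /H[? ? ?] : x < y0 by rewrite /y0 lt_max ltrDl ltr01 orbT.
  by split=> //; rewrite /y0 le_max lexx.
rewrite ge0_fin_numE ?mean_excess_ge0//.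
apply: le_lt_trans (mean_excess_leD _ yy0) _.
by rewrite lte_add_pinfty ?ltry// (le_lt_trans up)// ltry.
Qed.

Lemma mean_excess_equiv d (T : measurableType d) (R : realType)
    (P : probability T R) (X : {RV P >-> R}) (tau : R -> R) (alpha : R) :
  (forall a, P [set z | a < X z] = (tau a)%:E) -> (forall a, 0 < tau a) ->
  1 < alpha ->
  (forall a, 0 < a -> tau (a * x) / tau x @[x --> +oo] --> a `^ (- alpha)) ->
  fine (mean_excess P X y) / (y * tau y) @[y --> +oo] --> (alpha - 1)^-1.
Proof.
move=> tauE tau0 a1 tauRV; apply/cvgrPdist_le => eps eps0.
have fin := mean_excess_fin_num tauE tau0 a1 tauRV.
near=> y.
have [y0] : [/\ 0 < y,
    ((((alpha - 1)^-1 - eps) * (y * tau y))%:E <= mean_excess P X y)%E &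
    (mean_excess P X y <= (((alpha - 1)^-1 + eps) * (y * tau y))%:E)%E].
  by near: y; exact: mean_excess_near.
have yt0 : 0 < y * tau y by rewrite mulr_gt0.
rewrite -(fineK (fin y)) !lee_fin => lo up.
by rewrite distrC ler_distl ler_pdivlMr// lo ler_pdivrMr.
Unshelve. all: by end_near. Qed.

(** Dominated convergence along the integers, then monotonicity in the threshold. *)
Lemma mean_excess_cvg0 d (T : measurableType d) (R : realType)
    (P : probability T R) (X : {RV P >-> R}) :
  (forall y, mean_excess P X y \is a fin_num) ->
  fine (mean_excess P X y) @[y --> +oo] --> (0 : R).
Proof.
move=> fin.
have ge0 y : 0 <= fine (mean_excess P X y) by exact/fine_ge0/mean_excess_ge0.
have cv : mean_excess P X n%:R @[n --> \oo] --> (\int[P]_z (cst 0 z))%E.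
  have mf y : measurable_fun setT (fun z => (Num.max 0 (X z - y))%:E).
    exact/measurable_EFinP/measurable_excess.
  apply: (@dominated_cvg _ _ _ P setT measurableT
    (fun n z => (Num.max 0 (X z - n%:R))%:E) _
    (fun z => (Num.max 0 (X z - 0))%:E)) => //.
  - move=> z _; apply: cvg_EFin; first exact: nearW.
    apply: cvg_near_cst; near=> n; apply/max_idPl; rewrite subr_le0.
    by near: n; exact: nbhs_infty_ger.
  - apply/integrableP; split; first exact: mf.
    under eq_integral do rewrite gee0_abs ?lee_fin ?le_max ?lexx//.
    by rewrite -ge0_fin_numE ?fin// mean_excess_ge0.
  - move=> n z _; rewrite gee0_abs; last by rewrite lee_fin le_max lexx.
    by rewrite lee_fin le_max2// lerB.
rewrite integral0 in cv; move/fine_cvgP : cv => [_ /cvgrPdist_le cv].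
apply/cvgrPdist_le => eps eps0.
have [n _ /(_ n (leqnn n))/=] := cv _ eps0.
rewrite sub0r normrN ger0_norm// => Hn.
near=> y; rewrite sub0r normrN ger0_norm//; apply: le_trans Hn.
apply: fine_le => //; apply: mean_excess_nonincreasing.
by near: y; exact/nbhs_pinfty_ge/num_real.
Unshelve. all: by end_near. Qed.

(** * Laws of large numbers *)

Lemma bounded_Lfun d (T : measurableType d) (R : realType)
    (P : probability T R) (f : T -> R) (b r : R) : 1 <= r ->
  measurable_fun setT f -> (forall z, 0 <= f z <= b) -> f \in Lfun P r%:E.
Proof.
move=> r1 mf fb; rewrite inE; apply/andP; split; first exact/mem_set.
rewrite !inE/= /finite_norm unlock /Lnorm poweR_lty//=.
apply: (@le_lt_trans _ _ (\int[P]_z (b `^ r)%:E)%E); last first.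
  by rewrite integral_cst//= probability_setT mule1 ltry.
apply: ge0_le_integral => //.
- apply/measurable_EFinP; apply: (measurableT_comp (measurable_powR r)).
  exact: measurableT_comp.
- move=> z _; rewrite lee_fin; have /andP[f0 fb'] := fb z.
  rewrite ge0_ler_powR ?nnegrE ?(ger0_norm f0)//; first lra.
  exact: le_trans fb'.
Qed.

(* Fubini for the joint law of (X, Y), which is a product measure. *)
Lemma integral_indep d (T : measurableType d) (R : realType)
    (P : probability T R) (X Y : {RV P >-> R}) (f g : R -> R) :
  (forall A B, measurable A -> measurable B ->
    P (X @^-1` A `&` Y @^-1` B) = (P (X @^-1` A) * P (Y @^-1` B))%E) ->
  measurable_fun setT f -> measurable_fun setT g ->
  (forall x, 0 <= f x) -> (forall x, 0 <= g x) ->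
  (\int[P]_z (f (X z) * g (Y z))%:E =
   \int[P]_z (f (X z))%:E * \int[P]_z (g (Y z))%:E)%E.
Proof.
move=> XY mf mg f0 g0.
have mXY : measurable_fun setT (fun z => (X z, Y z)).
  exact: measurable_fun_pair.
pose h (u : R * R) := (f u.1 * g u.2)%:E.
have mh : measurable_fun setT h.
  apply/measurable_EFinP; apply: measurable_funM.
    exact: measurableT_comp.
  exact: measurableT_comp.
have h0 u : (0 <= h u)%E by rewrite lee_fin mulr_ge0.
transitivity (\int[pushforward P (fun z => (X z, Y z))]_u h u)%E.
  by rewrite ge0_integral_pushforward.
pose mXYf : {RV P >-> (R * R)%type} :=
  HB.pack (fun z => (X z, Y z)) (isMeasurableFun.Build _ _ _ _ _ mXY).
transitivity (\int[distribution P X \x distribution P Y]_u h u)%E.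
  rewrite -/(distribution P mXYf); apply: eq_measure_integral => A mA _.
  apply/esym; exact: product_measure_unique.
rewrite fubini_tonelli1//= /fubini_F.
transitivity (\int[distribution P X]_x
    ((f x)%:E * \int[distribution P Y]_y (g y)%:E))%E.
  apply: eq_integral => x _; rewrite -ge0_integralZl_EFin//.
  - by move=> y _; rewrite lee_fin.
  - exact/measurable_EFinP.
have gE : (\int[distribution P Y]_y (g y)%:E = \int[P]_z (g (Y z))%:E)%E.
  by rewrite ge0_integral_distribution//; exact/measurable_EFinP.
rewrite ge0_integralZr//.
- by rewrite gE ge0_integral_distribution//; exact/measurable_EFinP.
- exact/measurable_EFinP.
- by move=> x _; rewrite lee_fin.
- by apply: integral_ge0 => y _; rewrite lee_fin.
Qed.

(** The open upper half-lines generate the Borel sets and are stable under intersection, so the tail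
    determines the law. *)
Lemma integral_eq_tail d (T : measurableType d) (R : realType)
    (P : probability T R) (X Y : {RV P >-> R}) (f : R -> R) :
  (forall a, P [set z | a < X z] = P [set z | a < Y z]) ->
  measurable_fun setT f -> (forall x, 0 <= f x) ->
  (\int[P]_z (f (X z))%:E = \int[P]_z (f (Y z))%:E)%E.
Proof.
move=> XY mf f0.
transitivity (\int[distribution P X]_x (f x)%:E)%E.
  by rewrite ge0_integral_distribution//; exact/measurable_EFinP.
transitivity (\int[distribution P Y]_x (f x)%:E)%E; last first.
  by rewrite ge0_integral_distribution//; exact/measurable_EFinP.
apply: eq_measure_integral => A mA _.
apply: (measure_unique (@RGenOInfty.G R) (fun n => `]- n%:R, +oo[%classic)) => //.
- exact: RGenOInfty.measurableE.
- move=> _ _ [x ->] [y ->]; exists (Num.max x y).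
  by apply/seteqP; split => z /=; rewrite !in_itv/= !andbT gt_max;
    [case=> -> ->|move/andP].
- by move=> n; exists (- n%:R).
- apply/seteqP; split=> // x _; exists (Num.truncn (- x)).+1 => //=.
  by rewrite in_itv/= andbT ltrNl; exact: truncnS_gt.
- move=> _ [x ->]; have := XY x; rewrite /distribution /pushforward.
  by congr (P _ = P _); apply/seteqP; split => z /=; rewrite in_itv/= andbT.
- by move=> n; rewrite (le_lt_trans (probability_le1 _ _)) ?ltry.
Qed.

(** The form in which independence enters Chebyshev's inequality, through vanishing covariances. *)
Definition pairwise_independent d (T : measurableType d) (R : realType)
    (P : probability T R) (X : nat -> T -> R) : Prop :=
  forall i j A B, i != j -> measurable A -> measurable B ->
    P (X i @^-1` A `&` X j @^-1` B) = (P (X i @^-1` A) * P (X j @^-1` B))%E.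

Lemma variance_sum_uncorrelated d (T : measurableType d) (R : realType)
    (P : probability T R) (Y : nat -> T -> R) (v : R) :
  (forall i, Y i \in Lfun P 2%:E) ->
  (forall i j, i != j -> covariance P (Y i) (Y j) = 0%E) ->
  (forall i, ('V_P[Y i] <= v%:E)%E) ->
  forall n, ('V_P[fun z => (\sum_(i < n) Y i z)%R] <= (n%:R * v)%:E)%E.
Proof.
move=> Y2 Ycov Yv.
pose S n := (fun z => \sum_(i < n) Y i z) : T -> R.
have SS n : S n.+1 = S n \+ Y n.
  by apply/funext => z; rewrite /S big_ord_recr.
have S0 : S 0%N = cst 0 by apply/funext => z; rewrite /S big_ord0.
have S2 n : S n \in Lfun P 2%:E.
  elim: n => [|n ih]; first by rewrite S0 Lfun_cst.
  by rewrite SS rpredD// lee_fin ler1n.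
have cS n k : (n <= k)%N -> covariance P (S n) (Y k) = 0%E.
  elim: n => [|n ih] nk; first by rewrite S0 covariance_cst_l.
  by rewrite SS covarianceDl// ih ?(ltnW nk)// Ycov ?add0e// ltn_eqF.
elim=> [|n ih]; first by rewrite -/(S 0%N) S0 variance_cst mul0r.
rewrite -/(S n.+1) SS varianceD// cS// mule0 adde0 -natr1 mulrDl mul1r EFinD.
exact: leeD.
Qed.

(** The variance is bounded through the second moment [v], not through [b]: for the indicator of an
    exceedance [v] is the tail probability, of order p, and deviations of order n p then have
    probability O(1 / (n p)). *)
Lemma bounded_lln d (T : measurableType d) (R : realType)
    (P : probability T R) (X : nat -> {RV P >-> R}) (g : R -> R) (b v e : R)
    (n : nat) :
  pairwise_independent P (fun i => X i : T -> R) ->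
  (forall i a, P [set z | a < X i z] = P [set z | a < X 0%N z]) ->
  measurable_fun setT g -> (forall x, 0 <= g x <= b) ->
  (\int[P]_z (g (X 0%N z) ^+ 2)%:E <= v%:E)%E -> 0 < e -> (0 < n)%N ->
  (P [set z | (n%:R * e <= `|\sum_(i < n) g (X i z) -
      n%:R * fine (\int[P]_z (g (X 0%N z))%:E)|)%R] <=
   (v / (n%:R * e ^+ 2))%:E)%E.
Proof.
move=> indep ident mg gb gv e0 n0.
have g0 x : 0 <= g x by case/andP: (gb x).
pose Y i : T -> R := fun z => g (X i z).
have mY i : measurable_fun setT (Y i) by exact: measurableT_comp.
have Yb i z : 0 <= Y i z <= b by exact: gb.
have Y2 i : Y i \in Lfun P 2%:E by apply: bounded_Lfun => //; rewrite ler1n.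
have Y1 i : Y i \in Lfun P 1 by exact: bounded_Lfun.
have EY i : ('E_P[Y i] = \int[P]_z (g (X 0%N z))%:E)%E.
  by rewrite unlock; exact: (integral_eq_tail (ident i)).
have cY i j : i != j -> covariance P (Y i) (Y j) = 0%E.
  move=> ij; rewrite covarianceE//; last exact: Lfun2_mul_Lfun1.
  have -> : ('E_P[Y i * Y j] = 'E_P[Y i] * 'E_P[Y j])%E.
    by rewrite !unlock; apply: integral_indep => // A B mA mB; exact: indep.
  by rewrite subee// fin_numM// expectation_fin_num.
have VY i : ('V_P[Y i] <= v%:E)%E.
  rewrite varianceE//; apply: (@le_trans _ _ ('E_P[Y i ^+ 2])%E).
    have EY0 : (0 <= 'E_P[Y i])%E by apply: expectation_ge0 => z; exact: g0.
    by rewrite -[leRHS]sube0 leeB// expe2 mule_ge0.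
  apply: le_trans gv; rewrite unlock.
  rewrite (integral_eq_tail (ident i) (f := fun x => g x ^+ 2))//.
    exact: measurable_funX.
  by move=> x; exact: sqr_ge0.
pose S : T -> R := fun z => \sum_(i < n) Y i z.
have mS : measurable_fun setT S by exact: measurable_sum.
pose S' : {RV P >-> R} := HB.pack S (isMeasurableFun.Build _ _ _ _ _ mS).
have ES : fine ('E_P[S]) = n%:R * fine (\int[P]_z (g (X 0%N z))%:E)%E.
  rewrite unlock; have -> : (\int[P]_z (S z)%:E =
      \int[P]_z (\sum_(i < n) (Y i z)%:E))%E.
    by apply: eq_integral => z _; rewrite sumEFin.
  rewrite ge0_integral_sum//; last 2 first.
  - by move=> i; exact/measurable_EFinP.
  - by move=> i z _; rewrite lee_fin; exact: g0.
  have := expectation_fin_num (Y1 0%N); rewrite EY => /fineK m_fin.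
  under eq_bigr => i _ do rewrite (integral_eq_tail (ident i))// -m_fin.
  by rewrite sumEFin /= sumr_const card_ord mulr_natl.
have ne0 : 0 < n%:R * e by rewrite mulr_gt0// ltr0n.
have := @chebyshev _ _ _ P S' _ ne0; rewrite ES => /le_trans; apply.
have VS := variance_sum_uncorrelated Y2 cY VY n.
apply: le_trans (lee_wpmul2l _ VS) _.
  by rewrite lee_fin invr_ge0 exprn_ge0// ltW.
rewrite -EFinM lee_fin exprMn le_eqVlt; apply/orP; left; apply/eqP.
by field; rewrite !gt_eqF ?ltr0n.
Qed.

Lemma measurable_dist_ge d (T : measurableType d) (R : realType) (S : T -> R)
    (a e : R) : measurable_fun setT S -> measurable [set z | e <= `|S z - a|].
Proof.
move=> mS; rewrite -[X in measurable X]setTI.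
apply: (measurable_fun_ler (measurable_cst e) _ measurableT (Y := [set true])) => //.
by apply: measurableT_comp => //; exact: measurable_funB.
Qed.

Lemma count_lln d (T : measurableType d) (R : realType)
    (P : probability T R) (X : nat -> {RV P >-> R}) (tau : R -> R) (a e : R)
    (n : nat) :
  pairwise_independent P (fun i => X i : T -> R) ->
  (forall i a, P [set z | a < X i z] = (tau a)%:E) -> 0 < e -> (0 < n)%N ->
  (P [set z | (n%:R * e <= `|\sum_(i < n) (a < X i z)%R%:R -
      n%:R * tau a|)%R] <= (tau a / (n%:R * e ^+ 2))%:E)%E.
Proof.
move=> indep tauE e0 n0.
have tE : (\int[P]_z ((a < X 0%N z)%R%:R)%:E = (tau a)%:E)%E.
  rewrite -(tauE 0%N) -[RHS]mul1e -integral_gt_nat//.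
  by apply: eq_integral => z _; rewrite mul1r.
have := @bounded_lln _ _ _ P X (fun x => (a < x)%R%:R) 1 (tau a) e n indep.
rewrite tE; apply=> //.
- by move=> i c; rewrite !tauE.
- exact: measurable_gt_nat.
- by move=> x; case: (_ < _)%R; rewrite ?ler01 ?lexx.
- rewrite -tE le_eqVlt; apply/orP; left; apply/eqP; apply: eq_integral => z _.
  by case: (_ < _)%R; rewrite ?expr1n ?expr0n.
Qed.

Lemma markov_ge d (T : measurableType d) (R : realType)
    (P : probability T R) (W : T -> R) (m e : R) :
  measurable_fun setT W -> (forall z, 0 <= W z) -> 0 < e ->
  (\int[P]_z (W z)%:E <= m%:E)%E ->
  (P [set z | (e <= W z)%R] <= (m / e)%:E)%E.
Proof.
move=> mW W0 e0 Wm.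
pose W' : {RV P >-> R} := HB.pack W (isMeasurableFun.Build _ _ _ _ _ mW).
have := @markov _ _ _ P W' id e e0 (@measurable_id _ _ _) _ _ => H.
rewrite EFinM lee_pdivlMr// muleC; apply: le_trans Wm.
have -> : [set z | e <= W z] = [set z | (e%:E <= `|(W' z)%:E|)%E].
  by apply/seteqP; split => z /=; rewrite lee_fin ger0_norm.
apply: (le_trans (H _ _)) => //.
by rewrite unlock le_eqVlt; apply/orP; left; apply/eqP; apply: eq_integral => z _;
  rewrite /= ger0_norm.
Qed.

(* The summands (X_i - y)^+ may have infinite variance: Chebyshev's inequality
   is applied to their truncations at b - y and Markov's to the remainders
   (X_i - b)^+. *)
Lemma excess_lln d (T : measurableType d) (R : realType)
    (P : probability T R) (X : nat -> {RV P >-> R}) (tau : R -> R) (y b e : R)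
    (n : nat) :
  pairwise_independent P (fun i => X i : T -> R) ->
  (forall i a, P [set z | a < X i z] = (tau a)%:E) ->
  (forall c, mean_excess P (X 0%N) c \is a fin_num) ->
  y <= b -> 0 < e -> (0 < n)%N ->
  (P [set z | (n%:R * e <= `|\sum_(i < n) Num.max 0 (X i z - y) -
      n%:R * fine (mean_excess P (X 0%N) y)|)%R] <=
   (4 * (b - y) ^+ 2 * tau y / (n%:R * e ^+ 2) +
    4 * fine (mean_excess P (X 0%N) b) / e)%:E)%E.
Proof.
move=> indep tauE fin yb e0 n0.
have by0 : 0 <= b - y by rewrite subr_ge0.
have ident i a : P [set z | a < X i z] = P [set z | a < X 0%N z].
  by rewrite !tauE.
have nR : 0 < n%:R :> R by rewrite ltr0n.
pose g x := Num.min (Num.max 0 (x - y)) (b - y).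
pose r x := Num.max 0 (x - b).
have gr x : Num.max 0 (x - y) = g x + r x.
  rewrite /g /r; have [xy|xy] := leP x y.
    rewrite (@max_l _ _ 0 (x - y)) ?subr_le0// min_l// max_l ?addr0// subr_le0.
    exact: le_trans yb.
  rewrite (@max_r _ _ 0 (x - y)) ?subr_ge0 ?(ltW xy)//.
  have [xb|xb] := leP x b.
    by rewrite min_l ?lerD2r// max_l ?addr0// subr_le0.
  by rewrite min_r ?lerD2r ?(ltW xb)// max_r ?subr_ge0 ?(ltW xb)//; ring.
have gb x : 0 <= g x <= b - y.
  by rewrite /g le_min ge_min le_max lexx by0 lexx orbT.
have r0 x : 0 <= r x by rewrite le_max lexx.
have mg : measurable_fun setT g.
  apply: measurable_minr => //; apply: measurable_maxr => //.
  exact: measurable_funB.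
have mr : measurable_fun setT r.
  by apply: measurable_maxr => //; exact: measurable_funB.
pose hb := fine (mean_excess P (X 0%N) b).
pose hy := fine (mean_excess P (X 0%N) y).
pose m := fine (\int[P]_z (g (X 0%N z))%:E)%E.
have mgX i : measurable_fun setT (fun z => g (X i z)) by exact: measurableT_comp.
have mrX i : measurable_fun setT (fun z => r (X i z)) by exact: measurableT_comp.
have hE : hy = m + hb.
  have e1 : (mean_excess P (X 0%N) y = \int[P]_z (g (X 0%N z))%:E +
      mean_excess P (X 0%N) b)%E.
    rewrite /mean_excess -ge0_integralD//.
    - by apply: eq_integral => z _; rewrite -EFinD gr.
    - by move=> z _; rewrite lee_fin; case/andP: (gb (X 0%N z)).
    - exact/measurable_EFinP.
    - by move=> z _; rewrite lee_fin r0.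
    - exact/measurable_EFinP/measurable_excess.
  rewrite /hy e1 fineD//; have := fin y; rewrite e1 fin_numD => /andP[//].
(* [g] is at most [b - y] and vanishes unless the claim exceeds [y]. *)
have gv : (\int[P]_z (g (X 0%N z) ^+ 2)%:E <= ((b - y) ^+ 2 * tau y)%:E)%E.
  rewrite EFinM -(tauE 0%N) -integral_gt_nat ?sqr_ge0//.
  apply: ge0_le_integral => //.
  - by move=> z _; rewrite lee_fin sqr_ge0.
  - exact/measurable_EFinP/measurable_funX.
  - apply/measurable_EFinP/measurable_funM => //; exact: measurable_gt_nat.
  - move=> z _; rewrite lee_fin; have /andP[g0 gby] := gb (X 0%N z).
    have [yX|Xy] := ltP y (X 0%N z).
      by rewrite mulr1 ler_sqr ?nnegrE.
    have -> : g (X 0%N z) = 0.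
      by rewrite /g max_l ?subr_le0// min_l.
    by rewrite expr0n mulr0.
have e20 : 0 < e / 2 by rewrite divr_gt0.
have B1 := bounded_lln indep ident mg gb gv e20 n0.
(* [W] dominates the centred sum of the remainders in absolute value and has mean at most 2 n [hb],
   so that Markov's inequality applies with first moments only. *)
pose W z := \sum_(i < n) r (X i z) + n%:R * hb.
have hb0 : 0 <= hb by exact/fine_ge0/mean_excess_ge0.
have mW : measurable_fun setT W.
  by apply: measurable_funD => //; exact: measurable_sum.
have W0 z : 0 <= W z by rewrite addr_ge0 ?mulr_ge0 ?sumr_ge0.
have EW : (\int[P]_z (W z)%:E <= (2 * (n%:R * hb))%:E)%E.
  have -> : (\int[P]_z (W z)%:E = \int[P]_z (\sum_(i < n) (r (X i z))%:E +
      (n%:R * hb)%:E))%E.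
    by apply: eq_integral => z _; rewrite sumEFin.
  rewrite ge0_integralD//; last 3 first.
  - by move=> z _; apply: sume_ge0 => i _; rewrite lee_fin.
  - by apply: emeasurable_sum => i; exact/measurable_EFinP.
  - by move=> z _; rewrite lee_fin mulr_ge0.
  rewrite integral_cst//= probability_setT mule1 ge0_integral_sum//; last 2 first.
  - by move=> i; exact/measurable_EFinP/mrX.
  - by move=> i z _; rewrite lee_fin r0.
  under eq_bigr => i _ do rewrite (integral_eq_tail (ident i))//
    -/(mean_excess P (X 0%N) b) -(fineK (fin b)).
  rewrite sumEFin -EFinD lee_fin sumr_const card_ord -mulr_natl -/hb.
  by lra.
have ne20 : 0 < n%:R * (e / 2) by rewrite mulr_gt0.
have B2 := markov_ge mW W0 ne20 EW.
set A1 := [set z | _] in B1; set A2 := [set z | _] in B2.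
have mA1 : measurable A1 by apply: measurable_dist_ge; exact: measurable_sum.
have mA2 : measurable A2.
  rewrite -[X in measurable X]setTI.
  exact: (measurable_fun_ler (measurable_cst _) mW measurableT (Y := [set true])).
set A := [set z | _].
have mA : measurable A.
  apply: measurable_dist_ge; apply: measurable_sum => i.
  exact: measurable_excess.
have sub : A `<=` A1 `|` A2.
  move=> z; rewrite /A /A1 /A2 /= => zA.
  have [|] := leP (n%:R * (e / 2)) (W z); first by right.
  move=> Wz; left; rewrite -/m leNgt; apply/negP => gz.
  move: zA; rewrite leNgt => /negP; apply.
  under eq_bigr do rewrite gr.
  rewrite big_split/= -/hy hE mulrDr.
  set s1 := \sum_(i < n) g _ in gz *.
  set s2 := \sum_(i < n) r _.
  have s2W : `|s2 - n%:R * hb| <= W z.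
    rewrite ler_distl /W -/s2; have : 0 <= s2 by rewrite sumr_ge0.
    have : 0 <= n%:R * hb by rewrite mulr_ge0.
    by move=> ? ?; apply/andP; split; lra.
  have -> : s1 + s2 - (n%:R * m + n%:R * hb) = (s1 - n%:R * m) + (s2 - n%:R * hb).
    by ring.
  apply: (le_lt_trans (ler_normD _ _)).
  rewrite [ltRHS](_ : _ = n%:R * (e / 2) + n%:R * (e / 2)); last by
    field.
  by apply: ltrD => //; exact: le_lt_trans s2W Wz.
apply: (@le_trans _ _ (P A1 + P A2)%E).
  apply: le_trans (measureU2 _ mA1 mA2).
  by apply: le_measure; rewrite ?inE//; exact: measurableU.
apply: le_trans (leeD B1 B2) _.
rewrite -EFinD lee_fin le_eqVlt; apply/orP; left; apply/eqP.
by rewrite -/hb; field; rewrite !gt_eqF.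
Qed.

(** * The tail at the quantile *)

(** [F0] and [q < 1] bound the set of the infimum below by 0. Both this lemma and [quantile_ge_tail]
    stay strictly off the quantile, where F may jump. *)
Lemma quantile_lt_tail (R : realType) (F : R -> R) (q y : R) :
  (forall x, x <= 0 -> F x <= 0) -> q < 1 ->
  y < tail_quantile F q^-1 -> q < 1 - F y.
Proof.
move=> F0 q1; rewrite /tail_quantile /generalized_inverse invrK => yU.
rewrite ltrBrDr -ltrBrDl ltNge; apply/negP => Fy.
move: yU; rewrite ltNge => /negP; apply; apply: ge_inf => //.
exists 0 => x /= Fx; rewrite leNgt; apply/negP => x0.
by have := F0 _ (ltW x0); lra.
Qed.

Lemma quantile_ge_tail (R : realType) (F : R -> R) (q y : R) :
  (forall x x', x <= x' -> F x <= F x') -> (exists x, 1 - q <= F x) ->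
  tail_quantile F q^-1 < y -> 1 - F y <= q.
Proof.
move=> F_nd [x0 Fx0]; rewrite /tail_quantile /generalized_inverse invrK.
move=> Uy; have [x /= Fx xy] : exists2 x, 1 - q <= F x & x < y.
  apply: contrapT => /forall2NP H.
  suff : y <= inf [set x | 1 - q <= F x] by rewrite leNgt Uy.
  apply: lb_le_inf; first by exists x0.
  by move=> x /= Fx; case: (H x) => [//|/negP]; rewrite -leNgt.
by have := F_nd _ _ (ltW xy); lra.
Qed.

(** A quantile below [A] would force 1 - F(A) <= p(t), but 1 - F(A) is a fixed positive number and
    p(t) tends to 0. *)
Lemma quantile_cvgy (R : realType) (F p : R -> R) :
  (forall x x', x <= x' -> F x <= F x') -> (forall x, F x < 1) ->
  F x @[x --> +oo] --> (1 : R) ->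
  p t @[t --> +oo] --> (0 : R) -> (\forall t \near +oo, 0 < p t) ->
  tail_quantile F (p t)^-1 @[t --> +oo] --> +oo.
Proof.
move=> F_nd F1 F_cvg p0 p_gt0; apply/cvgryPge => A.
near=> t; rewrite leNgt; apply/negP => UA.
have pt0 : 0 < p t by near: t.
have : 1 - F A <= p t.
  apply: quantile_ge_tail UA => //.
  have : 1 - p t < 1 by rewrite ltrBlDr ltrDl.
  move=> /(cvgr_gt _ F_cvg) [x [_ H]]; exists (x + 1).
  by apply/ltW/H; rewrite ltrDl.
apply/negP; rewrite -ltNge; near: t.
by apply: (cvgr_lt _ p0); rewrite subr_gt0.
Unshelve. all: by end_near. Qed.

(** The quantile bounds do not compare tau(W) itself with p. Instead, p lies between tau(c W) and
    tau(d W) for d < 1 < c. With c^alpha = 1 + e and d^alpha = 1 - e, regular variation makes the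
    resulting bounds on tau(a W)/p tend to a^(-alpha) (1 + e) and a^(-alpha) (1 - e). *)
Lemma tail_at_quantile (R : realType) (tau p W : R -> R) (alpha a : R) :
  0 < alpha -> 0 < a -> (forall x, 0 < tau x) ->
  (forall b, 0 < b -> tau (b * x) / tau x @[x --> +oo] --> b `^ (- alpha)) ->
  (\forall t \near +oo, 0 < p t) -> W t @[t --> +oo] --> +oo ->
  (\forall t \near +oo, forall y, y < W t -> p t < tau y) ->
  (\forall t \near +oo, forall y, W t < y -> tau y <= p t) ->
  tau (a * W t) / p t @[t --> +oo] --> a `^ (- alpha).
Proof.
move=> alpha0 a0 tau0 RV p0 Woo lo up.
have aa0 : 0 < a `^ (- alpha) by exact: powR_gt0.
have comp (e : R) : 0 < 1 + e ->
    let c := (1 + e) `^ alpha^-1 in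
    [/\ 0 < c & tau (a * W t) / tau (c * W t) @[t --> +oo] -->
       a `^ (- alpha) * (1 + e)].
  move=> e0 c; have c0 : 0 < c by exact: powR_gt0.
  split=> //; have ac0 : 0 < a / c by rewrite divr_gt0.
  have cE : (a / c) `^ (- alpha) = a `^ (- alpha) * (1 + e).
    rewrite powRM ?ltW ?invr_gt0// -powR_inv1 ?ltW// -powRrM mulN1r opprK.
    by rewrite -powRrM mulVf ?gt_eqF// powRr1 ?ltW.
  rewrite -cE; have cW : c * W t @[t --> +oo] --> +oo.
    apply/cvgryPge => A; near=> t; rewrite mulrC -ler_pdivrMr//.
    by near: t; move/cvgryPge : Woo; exact.
  have := cvg_comp _ _ cW (RV _ ac0); apply: cvg_trans; apply: near_eq_cvg.
  by apply: nearW => t /=; rewrite mulrA divfK ?gt_eqF.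
apply/cvgrPdist_le => eps eps0.
pose e := Num.min (1 / 2) (eps / (2 * a `^ (- alpha))).
have e0 : 0 < e by rewrite lt_min !divr_gt0// mulr_gt0.
have e1 : e <= 1 / 2 by rewrite ge_min lexx.
have ea : a `^ (- alpha) * e <= eps / 2.
  rewrite -ler_pdivlMl// ge_min; apply/orP; right.
  by rewrite le_eqVlt; apply/orP; left; apply/eqP; field; rewrite gt_eqF.
have ai0 : 0 < alpha^-1 by rewrite invr_gt0.
have e1' : 0 < 1 + e by lra.
have e2' : 0 < 1 + - e by lra.
have [c0 cvgc] := comp e e1'; have [d0 cvgd] := comp (- e) e2'.
set c := (1 + e) `^ alpha^-1 in c0 cvgc.
set d := (1 + - e) `^ alpha^-1 in d0 cvgd.
have p1 : 1 `^ alpha^-1 = 1 :> R by rewrite powR1.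
have c1 : 1 < c.
  rewrite -[X in X < _]p1 gt0_ltr_powR ?nnegrE ?ler01 ?ltW//.
  by rewrite ltrDl.
have d1 : d < 1.
  rewrite -[X in _ < X]p1 gt0_ltr_powR ?nnegrE ?ler01 ?ltW//.
  by rewrite gtrDl oppr_lt0.
have e20 : 0 < eps / 2 by rewrite divr_gt0.
move/cvgrPdist_le : cvgc => /(_ _ e20) Hc.
move/cvgrPdist_le : cvgd => /(_ _ e20) Hd.
near=> t.
have pt0 : 0 < p t by near: t.
have Wt0 : 0 < W t by near: t; move/cvgryPgt : Woo; exact.
have hc : tau (c * W t) <= p t.
  by move: (near up t) => H; apply: (H _ _); rewrite ?ltr_pMl//; near: t.
have hd : p t < tau (d * W t).
  by move: (near lo t) => H; apply: (H _ _); rewrite ?gtr_pMl//; near: t.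
have u1 : tau (a * W t) / p t <= tau (a * W t) / tau (c * W t).
  by rewrite ler_pM2l// lef_pV2 ?posrE.
have u2 : tau (a * W t) / tau (d * W t) <= tau (a * W t) / p t.
  by rewrite ler_pM2l// lef_pV2 ?posrE// ltW.
have : `|a `^ (- alpha) * (1 + e) - tau (a * W t) / tau (c * W t)| <= eps / 2.
  by near: t.
have : `|a `^ (- alpha) * (1 + - e) - tau (a * W t) / tau (d * W t)| <= eps / 2.
  by near: t.
rewrite !ler_distl => /andP[v1 v2] /andP[v3 v4]; apply/andP; split; lra.
Unshelve. all: by end_near. Qed.

Lemma excess_at_quantile (R : realType) (tau h p W : R -> R) (alpha a : R) :
  0 < alpha -> 0 < a -> (forall x, 0 < tau x) ->
  tau (a * W t) / p t @[t --> +oo] --> a `^ (- alpha) ->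
  h y / (y * tau y) @[y --> +oo] --> (alpha - 1)^-1 ->
  (\forall t \near +oo, 0 < p t) -> W t @[t --> +oo] --> +oo ->
  h (a * W t) / (p t * W t) @[t --> +oo] -->
    (alpha - 1)^-1 * (a * a `^ (- alpha)).
Proof.
move=> alpha0 a0 tau0 tauW hE p0 Woo.
have aW : a * W t @[t --> +oo] --> +oo.
  apply/cvgryPge => A; near=> t; rewrite mulrC -ler_pdivrMr//.
  by near: t; move/cvgryPge : Woo; exact.
have hW : h (a * W t) / (a * W t * tau (a * W t)) @[t --> +oo] -->
    (alpha - 1)^-1 by exact: (cvg_comp _ _ aW hE).
have taW : a * (tau (a * W t) / p t) @[t --> +oo] --> a * a `^ (- alpha).
  exact: (cvgMl_tmp tauW).
apply: cvg_trans (cvgM hW taW); apply: near_eq_cvg.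
near=> t => /=; field.
have -> : p t != 0 by rewrite gt_eqF//; near: t.
have -> : W t != 0 by rewrite gt_eqF//; near: t; move/cvgryPgt : Woo; exact.
by rewrite !gt_eqF.
Unshelve. all: by end_near. Qed.

(** p W is h(W) divided by h(W)/(p W). Its smallness makes X*_(n-s) and Lambda_s negligible against
    n. *)
Lemma scaled_quantile_cvg0 (R : realType) (h p W : R -> R) (l : R) :
  0 < l -> h y @[y --> +oo] --> (0 : R) ->
  h (W t) / (p t * W t) @[t --> +oo] --> l ->
  (\forall t \near +oo, 0 < p t) -> W t @[t --> +oo] --> +oo ->
  p t * W t @[t --> +oo] --> (0 : R).
Proof.
move=> l0 h0 hl p0 Woo.
have hW0 : h (W t) @[t --> +oo] --> (0 : R) by exact: (cvg_comp _ _ Woo h0).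
have hlV : (h (W t) / (p t * W t))^-1 @[t --> +oo] --> l^-1.
  exact: (cvgV (lt0r_neq0 l0) hl).
have H : h (W t) * (h (W t) / (p t * W t))^-1 @[t --> +oo] --> 0 * l^-1.
  exact: cvgM hW0 hlV.
rewrite mul0r in H; apply: cvg_trans H; apply: near_eq_cvg.
have hpos : \forall t \near +oo, 0 < h (W t) / (p t * W t).
  exact: (cvgr_gt _ hl).
near=> t => /=.
have pt : 0 < p t by near: t.
have Wt : 0 < W t by near: t; move/cvgryPgt : Woo; exact.
have h0' : h (W t) != 0.
  have : 0 < h (W t) / (p t * W t) by near: t.
  by rewrite pmulr_lgt0 ?invr_gt0 ?mulr_gt0// => /gt_eqF ->.
by field; rewrite h0' !gt_eqF.
Unshelve. all: by end_near. Qed.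

(** Divided by alpha - 1, it says that raising the threshold from W to (1 + a) W lowers the limiting
    mean excess, in units of p W, by at most [a]. *)
Lemma powR_1D_lower (R : realType) (alpha a : R) : 1 < alpha -> 0 < a ->
  1 - (alpha - 1) * a <= (1 + a) * (1 + a) `^ (- alpha).
Proof.
move=> a1 a0; have a0' : 0 < 1 + a by lra.
have -> : (1 + a) * (1 + a) `^ (- alpha) = (1 + a) `^ (- (alpha - 1)).
  rewrite -[X in X * _](powRr1 (ltW a0')) -powRD ?(gt_eqF a0') ?implybT//.
  by congr (_ `^ _); ring.
rewrite /powR gt_eqF//; apply: le_trans (expR_ge1Dx _).
rewrite lerD2l mulNr lerN2 ler_pM2l ?subr_gt0//.
by rewrite le_ln1Dx// (lt_trans _ a0)// oppr_lt0.
Qed.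

(** Up to the factor 1/(alpha - 1), M M^(-alpha) is the limiting mean excess over M W in units of p
    W; the lemma supplies a truncation level. *)
Lemma powR_negM_small (R : realType) (alpha eps : R) : 1 < alpha -> 0 < eps ->
  forall A, exists2 M, A <= M &
    M * M `^ (- alpha) <= eps.
Proof.
move=> a1 eps0; have b0 : 0 < alpha - 1 by rewrite subr_gt0.
pose M := (eps^-1) `^ (alpha - 1)^-1.
have M0 : 0 < M by rewrite powR_gt0// invr_gt0.
move=> A; exists (Num.max M A); first by rewrite le_max lexx orbT.
set B := Num.max M A.
have MB : M <= B by rewrite le_max lexx.
have B0 : 0 < B by exact: lt_le_trans MB.
have -> : B * B `^ (- alpha) = (B `^ (alpha - 1))^-1.
  rewrite -powRN -[X in X * _](powRr1 (ltW B0)) -powRD ?(gt_eqF B0) ?implybT//.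
  by congr (_ `^ _); ring.
rewrite -[leRHS]invrK lef_pV2 ?posrE ?invr_gt0 ?powR_gt0//.
apply: (@le_trans _ _ (M `^ (alpha - 1))).
  by rewrite /M -powRrM mulVf ?gt_eqF// powRr1// ltW// invr_gt0.
by apply: ge0_ler_powR => //; rewrite ?nnegrE ltW.
Qed.

(** * Typical samples *)

(** The two counts locate X*_(n-s); the excesses over W and (1 + delta) W bound Lambda_s from above
    and from below; for nonnegative claims the excess over 0 is the total. Tolerances are [eta]
    times the scales p, p W and 1. *)
Definition typical_sample (R : realType) (tau h : R -> R) (p W delta eta : R)
    (n : nat) (x : nat -> R) : Prop :=
  let dev (f : R -> R) m e := `|\sum_(i < n) f (x i) - n%:R * m| < n%:R * e in
  [/\ dev (fun y => ((1 + delta) * W < y)%R%:R) (tau ((1 + delta) * W))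
          (eta * p),
      dev (fun y => ((1 - delta) * W < y)%R%:R) (tau ((1 - delta) * W))
          (eta * p),
      dev (fun y => Num.max 0 (y - W)) (h W) (eta * p * W),
      dev (fun y => Num.max 0 (y - (1 + delta) * W)) (h ((1 + delta) * W))
          (eta * p * W) &
      dev (fun y => Num.max 0 (y - 0)) (h 0) eta].

(** [rp] and [rm] stand for (1 + delta)^(-alpha) and (1 - delta)^(-alpha). The margin 3 eta absorbs
    the error of tau, that of the count, and the rounding of [s], which costs at most 1 <= eta p
    n. *)
Lemma typical_sample_order_stats (R : realType) (tau h : R -> R)
    (p W delta eta kappa rp rm : R) (n : nat) (x : nat -> R) :
  let s := Num.truncn (p * n%:R) in
  typical_sample tau h p W delta eta n x ->
  (forall i, 0 <= x i) ->
  0 < p < 1 -> 0 < W -> 0 < delta < 1 -> 0 < eta < 1 -> 0 <= kappa ->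
  1 <= eta * (p * n%:R) -> p * W <= eta ->
  rp + 3 * eta <= 1 -> 1 + 3 * eta <= rm ->
  tau ((1 + delta) * W) <= p * (rp + eta) ->
  p * (rm - eta) <= tau ((1 - delta) * W) ->
  h W <= p * W * (kappa + eta) ->
  p * W * (kappa - delta - eta) <= h ((1 + delta) * W) ->
  [/\ `|largest_sum x n s - (1 + kappa) * (n%:R * (p * W))| <=
        (2 * delta + 3 * eta) * (n%:R * (p * W)),
      `|order_stat x n (n - s) - W| <= delta * W &
      `|smallest_sum x n s - h 0 * n%:R| <= eta * (6 + kappa) * n%:R].
Proof.
move=> s [cp cm e0 ed tot] x0 /andP[p0 p1] W0 /andP[d0 d1] /andP[eta0 eta1].
move=> kappa0 npe pW rpe rme taup taum h0 hd.
have pn0 : 0 < p * n%:R by nra.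
have n0 : 0 < n%:R :> R by nra.
have /andP[sle slt] : s%:R <= p * n%:R < s.+1%:R by apply: truncn_itv; exact: ltW.
rewrite -natr1 in slt.
have sn : (s < n)%N by rewrite -(ltr_nat R); nra.
have pn1 : 1 <= p * n%:R by nra.
have xi_le : order_stat x n (n - s) <= (1 + delta) * W.
  apply: order_stat_le => //; apply/ltW.
  move: cp; rewrite ltr_distl => /andP[_ cp]; apply: lt_le_trans cp _.
  have : n%:R * tau ((1 + delta) * W) <= n%:R * (p * (rp + eta)).
    by rewrite ler_pM2l.
  have : (p * n%:R) * (rp + 3 * eta) <= (p * n%:R) * 1 by rewrite ler_pM2l.
  by nra.
have xi_ge : (1 - delta) * W < order_stat x n (n - s).
  apply: order_stat_gt => //.
  move: cm; rewrite ltr_distl => /andP[cm _]; apply: le_lt_trans _ cm.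
  have : n%:R * (p * (rm - eta)) <= n%:R * tau ((1 - delta) * W).
    by rewrite ler_pM2l.
  have : (p * n%:R) * (1 + 3 * eta) <= (p * n%:R) * rm by rewrite ler_pM2l.
  by nra.
have npW0 : 0 < n%:R * (p * W) by rewrite !mulr_gt0.
have L_le : largest_sum x n s <= (1 + kappa + 2 * eta) * (n%:R * (p * W)).
  apply: le_trans (largest_sum_le x W sn) _.
  move: e0; rewrite ltr_distl => /andP[_ e0].
  have : n%:R * h W <= n%:R * (p * W * (kappa + eta)) by rewrite ler_pM2l.
  have : s%:R * W <= p * n%:R * W by rewrite ler_pM2r.
  by nra.
have L_ge : (1 + kappa - (2 * delta + 3 * eta)) * (n%:R * (p * W)) <= largest_sum x n s.
  have := @largest_sum_ge R x n s ((1 - delta) * W) ((1 + delta) * W) sn.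
  rewrite xi_le (ltW xi_ge) => /(_ isT); apply: le_trans.
  move: ed; rewrite ltr_distl => /andP[ed _].
  have H1 : n%:R * (p * W * (kappa - delta - eta)) <= n%:R * h ((1 + delta) * W).
    by rewrite ler_pM2l.
  have dW : 0 < (1 - delta) * W by rewrite mulr_gt0// subr_gt0.
  have H2 : (p * n%:R - 1) * ((1 - delta) * W) <= s%:R * ((1 - delta) * W).
    by rewrite ler_pM2r//; lra.
  have H3 : (1 - delta) * W <= eta * (n%:R * (p * W)).
    have : 1 * W <= eta * (p * n%:R) * W by rewrite ler_pM2r.
    have : 0 < delta * W by rewrite mulr_gt0.
    by nra.
  have H4 : 0 < delta * (n%:R * (p * W)) by rewrite mulr_gt0.
  by nra.
split.
- rewrite ler_distl; apply/andP; split; first by nra.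
  apply: le_trans L_le _; rewrite -mulrDl ler_pM2r//; lra.
- by rewrite ler_distl; apply/andP; split; nra.
(* Sigma_s is the total minus X*_(n-s) and Lambda_s. As p W <= eta and p n >= 1, these are at most 2
   eta n and eta (3 + kappa) n; the error eta n of the total completes 6 + kappa. *)
have tot' : \sum_(i < n) Num.max 0 (x i - 0) = \sum_(i < n) x i.
  by apply: eq_bigr => i _; rewrite subr0 max_r.
move: tot; rewrite tot' -(sum_order_stats x sn) ltr_distl => /andP[t1 t2].
have Lbound : largest_sum x n s <= eta * (1 + kappa + 2) * n%:R.
  apply: le_trans L_le _.
  have : n%:R * (p * W) <= n%:R * eta by rewrite ler_pM2l.
  have neta0 : 0 < n%:R * eta by rewrite mulr_gt0.
  move=> pWn; have : (1 + kappa + 2 * eta) * (n%:R * (p * W)) <=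
      (1 + kappa + 2) * (n%:R * eta) by apply: ler_pM => //; lra.
  by nra.
have xibound : order_stat x n (n - s) <= 2 * eta * n%:R.
  apply: le_trans xi_le _; apply: (@le_trans _ _ (2 * W)).
    by rewrite ler_pM2r//; lra.
  rewrite -mulrA ler_pM2l//.
  have : 1 * W <= p * n%:R * W by rewrite ler_pM2r.
  have : p * W * n%:R <= eta * n%:R by rewrite ler_pM2r.
  by nra.
have xi0 : 0 <= order_stat x n (n - s).
  by apply: ltW; apply: lt_trans xi_ge; rewrite mulr_gt0// subr_gt0.
have Lge0 : 0 <= largest_sum x n s.
  rewrite largest_sumE; apply: sumr_ge0 => j _.
  have [jn|jn] := ltnP j (size (sort <=%R (mkseq x n))).
    have : nth 0 (sort <=%R (mkseq x n)) j \in mkseq x n.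
      by rewrite -(mem_sort <=%R) mem_nth.
    by move=> /mapP[k _ ->].
  by rewrite nth_default.
rewrite ler_distl; apply/andP; split; nra.
Qed.

(** * Exceptional events of small probability *)

Lemma sigma_algebra_of_family_measurable d (T : measurableType d)
    (R : realType) (X : nat -> T -> R) (i : nat) :
  measurable_fun (T := g_sigma_algebraType
     (\bigcup_(i in [set: nat]) preimage_set_system setT (X i) measurable))
   setT (X i).
Proof.
move=> _ Y mY; apply: sub_sigma_algebra; exists i => //=.
by exists Y.
Qed.

(** Membership in the sigma-algebra of the claims is what will make the event independent of N(t).
    It is ordinary measurability on [T] re-equipped with that sigma-algebra. *)
Lemma sum_dist_ge_measurable d (T : measurableType d) (R : realType)
    (X : nat -> {mfun T >-> R}) (f : R -> R) (n : nat) (a e : R) :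
  measurable_fun setT f ->
  measurable [set z | e <= `|\sum_(i < n) f (X i z) - a|] /\
  sigma_algebra_of_family setT (fun i => X i : T -> R)
    [set z | e <= `|\sum_(i < n) f (X i z) - a|].
Proof.
move=> mf; split.
  by apply: measurable_dist_ge; apply: measurable_sum => i; exact: measurableT_comp.
apply: (@measurable_dist_ge _ (g_sigma_algebraType
  (\bigcup_(i in [set: nat]) preimage_set_system setT (X i : T -> R) measurable))).
apply: measurable_sum => i; apply: measurableT_comp => //.
exact: sigma_algebra_of_family_measurable.
Qed.

(** The bound of [count_lln] becomes (tau(a W)/p) / (eta^2 p n), whose numerator is eventually at
    most l + 1; this dictates [K]. *)
Lemma count_atypical d (T : measurableType d) (R : realType)
    (P : probability T R) (X : nat -> {RV P >-> R}) (tau p W : R -> R)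
    (l a eta eps : R) :
  pairwise_independent P (fun i => X i : T -> R) ->
  (forall i a, P [set z | a < X i z] = (tau a)%:E) ->
  (\forall t \near +oo, 0 < p t) ->
  tau (a * W t) / p t @[t --> +oo] --> l -> 0 <= l ->
  0 < eta -> 0 < eps ->
  exists2 K, 0 < K & \forall t \near +oo, forall n, K <= p t * n%:R ->
  (P [set z | (n%:R * (eta * p t) <=
      `|\sum_(i < n) (a * W t < X i z)%R%:R - n%:R * tau (a * W t)|)%R] <= eps%:E)%E.
Proof.
move=> indep tauE p0 tauW l0 eta0 eps0.
exists ((l + 1) / (eta ^+ 2 * eps)).
  by rewrite divr_gt0 ?mulr_gt0 ?exprn_gt0//; lra.
near=> t => n Kn.
have pt : 0 < p t by near: t.
have tl : tau (a * W t) / p t <= l + 1.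
  by near: t; apply: (cvgr_le _ tauW); rewrite ltrDl.
have pn : 0 < p t * n%:R.
  by apply: lt_le_trans Kn; rewrite divr_gt0 ?mulr_gt0 ?exprn_gt0//; lra.
have nR : 0 < n%:R :> R by move: pn; rewrite pmulr_rgt0.
have n0 : (0 < n)%N by rewrite -(ltr_nat R).
apply: le_trans (count_lln (a * W t) indep tauE (mulr_gt0 eta0 pt) n0) _.
rewrite lee_fin.
have -> : tau (a * W t) / (n%:R * (eta * p t) ^+ 2) =
    (tau (a * W t) / p t) / (eta ^+ 2 * (p t * n%:R)).
  by field; rewrite !gt_eqF// ltr0n.
rewrite ler_pdivrMr ?mulr_gt0 ?exprn_gt0//; apply: (le_trans tl).
move: Kn; rewrite ler_pdivrMr ?mulr_gt0 ?exprn_gt0// => /le_trans; apply.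
by rewrite le_eqVlt; apply/orP; left; apply/eqP; ring.
Unshelve. all: by end_near. Qed.

Lemma excess_atypical d (T : measurableType d) (R : realType)
    (P : probability T R) (X : nat -> {RV P >-> R}) (tau p W : R -> R)
    (alpha a eta eps : R) :
  let h y := fine (mean_excess P (X 0%N) y) in
  pairwise_independent P (fun i => X i : T -> R) ->
  (forall i a, P [set z | a < X i z] = (tau a)%:E) ->
  (forall y, mean_excess P (X 0%N) y \is a fin_num) ->
  (\forall t \near +oo, 0 < p t) -> (\forall t \near +oo, 0 < W t) ->
  1 < alpha -> 0 < a ->
  (forall b, 0 < b -> tau (b * W t) / p t @[t --> +oo] --> b `^ (- alpha)) ->
  (forall b, 0 < b -> h (b * W t) / (p t * W t) @[t --> +oo] -->
    (alpha - 1)^-1 * (b * b `^ (- alpha))) ->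
  0 < eta -> 0 < eps ->
  exists2 K, 0 < K & \forall t \near +oo, forall n, K <= p t * n%:R ->
  (P [set z | (n%:R * (eta * p t * W t) <=
      `|\sum_(i < n) Num.max 0 (X i z - a * W t) - n%:R * h (a * W t)|)%R]
   <= eps%:E)%E.
Proof.
move=> h indep tauE fin p0 W0 a1 a0 tauW hW eta0 eps0.
have k0 : 0 < (alpha - 1)^-1 by rewrite invr_gt0 subr_gt0.
set kappa := (alpha - 1)^-1 in hW k0.
have c0 : 0 < eps * eta / (16 * kappa) by rewrite divr_gt0 ?mulr_gt0.
(* Truncation at M W: the Markov term, 4/eta times h(M W)/(p W), is eventually at most eps/2, and
   [K] then does the same for the Chebyshev term. The limit is kept below eps eta/16 to have room
   under eps eta/8. *)
have [M aM Mc] := powR_negM_small a1 c0 a.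
have M0 : 0 < M by exact: lt_le_trans aM.
pose D := a `^ (- alpha) + 1.
have D0 : 0 < D by rewrite ltr_wpDl// powR_ge0.
have MD0 : 0 <= (M - a) ^+ 2 by exact: sqr_ge0.
exists (8 * ((M - a) ^+ 2 + 1) * D / (eta ^+ 2 * eps)).
  by rewrite divr_gt0 ?mulr_gt0 ?exprn_gt0//; lra.
near=> t => n Kn.
have pt : 0 < p t by near: t.
have Wt : 0 < W t by near: t.
have tl : tau (a * W t) / p t <= D.
  by near: t; apply: (cvgr_le _ (tauW _ a0)); rewrite ltrDl.
have hM : h (M * W t) / (p t * W t) <= eps * eta / 8.
  near: t; apply: (cvgr_le _ (hW _ M0)).
  apply: (@le_lt_trans _ _ (eps * eta / 16)).
    rewrite -ler_pdivlMl//; apply: le_trans Mc _.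
    by rewrite le_eqVlt; apply/orP; left; apply/eqP; field; rewrite gt_eqF.
  by rewrite ltr_pM2l ?mulr_gt0// ltf_pV2 ?posrE//; lra.
have pn : 0 < p t * n%:R.
  by apply: lt_le_trans Kn; rewrite divr_gt0 ?mulr_gt0 ?exprn_gt0//; lra.
have nR : 0 < n%:R :> R by move: pn; rewrite pmulr_rgt0.
have n0 : (0 < n)%N by rewrite -(ltr_nat R).
have aMW : a * W t <= M * W t by rewrite ler_pM2r.
have e0 : 0 < eta * p t * W t by rewrite !mulr_gt0.
apply: le_trans (excess_lln indep tauE fin aMW e0 n0) _.
rewrite lee_fin.
have -> : 4 * (M * W t - a * W t) ^+ 2 * tau (a * W t) /
    (n%:R * (eta * p t * W t) ^+ 2) =
    4 * (M - a) ^+ 2 * (tau (a * W t) / p t) / (eta ^+ 2 * (p t * n%:R)).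
  by field; rewrite !gt_eqF// ltr0n.
have -> : 4 * fine (mean_excess P (X 0%N) (M * W t)) / (eta * p t * W t) =
    4 / eta * (h (M * W t) / (p t * W t)).
  by rewrite /h; field; rewrite !gt_eqF.
have -> : eps = eps / 2 + 4 / eta * (eps * eta / 8).
  by field; rewrite gt_eqF.
apply: lerD; last by rewrite ler_pM2l// divr_gt0.
rewrite ler_pdivrMr ?mulr_gt0 ?exprn_gt0//.
apply: (@le_trans _ _ (4 * ((M - a) ^+ 2 + 1) * D)).
  apply: ler_pM => //; first by rewrite mulr_ge0.
  - rewrite divr_ge0 ?(ltW pt)//; exact: tail_ge0 (tauE 0%N) _.
  - by rewrite ler_pM2l// lerDl.
move: Kn; rewrite ler_pdivrMr ?mulr_gt0 ?exprn_gt0// => Kn.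
have : p t * n%:R * (eta ^+ 2 * eps) = 2 * (eps / 2 * (eta ^+ 2 * (p t * n%:R))).
  by field.
by move=> e; rewrite e in Kn; lra.
Unshelve. all: by end_near. Qed.

Lemma mean_atypical d (T : measurableType d) (R : realType)
    (P : probability T R) (X : nat -> {RV P >-> R}) (tau p : R -> R)
    (eta eps : R) :
  let h y := fine (mean_excess P (X 0%N) y) in
  pairwise_independent P (fun i => X i : T -> R) ->
  (forall i a, P [set z | a < X i z] = (tau a)%:E) ->
  (forall y, mean_excess P (X 0%N) y \is a fin_num) ->
  (\forall t \near +oo, 0 < p t < 1) ->
  0 < eta -> 0 < eps ->
  exists2 K, 0 < K & \forall t \near +oo, forall n, K <= p t * n%:R ->
  (P [set z | (n%:R * eta <=
      `|\sum_(i < n) Num.max 0 (X i z - 0) - n%:R * h 0|)%R] <= eps%:E)%E.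
Proof.
move=> h indep tauE fin p01 eta0 eps0.
have c0 : 0 < eps * eta / 8 by rewrite divr_gt0 ?mulr_gt0.
have [b b0 hb] : exists2 b, 0 <= b & h b <= eps * eta / 8.
  have [x [_ H]] := cvgr_le _ (mean_excess_cvg0 fin) _ c0.
  exists (Num.max 0 (x + 1)); first by rewrite le_max lexx.
  by apply: H; rewrite lt_max ltrDl ltr01 orbT.
have t1 : tau 0 <= 1.
  by rewrite -lee_fin -(tauE 0%N) probability_le1//; exact: measurable_gt.
have t0 : 0 <= tau 0 := tail_ge0 (tauE 0%N) 0.
exists (8 * (b ^+ 2 + 1) / (eta ^+ 2 * eps)).
  by rewrite divr_gt0 ?mulr_gt0 ?exprn_gt0//; have := sqr_ge0 b; lra.
near=> t => n Kn.
have /andP[pt0 pt1] : 0 < p t < 1 by near: t.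
have b21 : 0 < b ^+ 2 + 1 by have := sqr_ge0 b; lra.
have pn : 0 < p t * n%:R.
  by apply: lt_le_trans Kn; rewrite divr_gt0 ?mulr_gt0 ?exprn_gt0.
have nR : 0 < n%:R :> R by move: pn; rewrite pmulr_rgt0.
have n0 : (0 < n)%N by rewrite -(ltr_nat R).
apply: le_trans (excess_lln indep tauE fin b0 eta0 n0) _.
rewrite lee_fin subr0.
have -> : eps = eps / 2 + 4 * (eps * eta / 8) / eta.
  by field; rewrite gt_eqF.
apply: lerD; last first.
  by rewrite ler_pM2r ?invr_gt0// ler_pM2l.
rewrite ler_pdivrMr ?mulr_gt0 ?exprn_gt0//.
apply: (@le_trans _ _ (4 * (b ^+ 2 + 1))).
  rewrite -[leRHS]mulr1; apply: ler_pM => //; first by rewrite mulr_ge0 ?sqr_ge0.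
  by rewrite ler_pM2l// lerDl.
move: Kn; rewrite ler_pdivrMr ?mulr_gt0 ?exprn_gt0// => Kn.
(* The Chebyshev term involves n alone; p(t) < 1 turns a lower bound on p n into one on n. *)
have H : p t * n%:R * (eta ^+ 2 * eps) <= n%:R * (eta ^+ 2 * eps).
  by rewrite ler_pM2r ?mulr_gt0 ?exprn_gt0// ler_piMl// ltW.
have : n%:R * (eta ^+ 2 * eps) = 2 * (eps / 2 * (n%:R * eta ^+ 2)) by field.
by move=> e; rewrite e in H; lra.
Unshelve. all: by end_near. Qed.

(** [K] is chosen before [t] and [n], which permits substituting N(t) for [n]. [B] is the union of
    five deviation events of probability at most eps/5. *)
Lemma atypical_small d (T : measurableType d) (R : realType)
    (P : probability T R) (X : nat -> {RV P >-> R}) (tau p W : R -> R)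
    (alpha delta eta eps : R) :
  let h y := fine (mean_excess P (X 0%N) y) in
  pairwise_independent P (fun i => X i : T -> R) ->
  (forall i a, P [set z | a < X i z] = (tau a)%:E) ->
  (forall y, mean_excess P (X 0%N) y \is a fin_num) ->
  (\forall t \near +oo, 0 < p t < 1) -> (\forall t \near +oo, 0 < W t) ->
  1 < alpha ->
  (forall b, 0 < b -> tau (b * W t) / p t @[t --> +oo] --> b `^ (- alpha)) ->
  (forall b, 0 < b -> h (b * W t) / (p t * W t) @[t --> +oo] -->
    (alpha - 1)^-1 * (b * b `^ (- alpha))) ->
  0 < delta < 1 -> 0 < eta -> 0 < eps ->
  exists2 K, 0 < K & \forall t \near +oo, forall n, K <= p t * n%:R ->
  exists B, [/\ measurable B,
    sigma_algebra_of_family setT (fun i => X i : T -> R) B,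
    (P B <= eps%:E)%E &
    forall z, ~ B z ->
      typical_sample tau h (p t) (W t) delta eta n (fun i => X i z)].
Proof.
move=> h indep tauE fin p01 W0 a1 tauW hW /andP[d0 d1] eta0 eps0.
have p0 : \forall t \near +oo, 0 < p t.
  by apply: filterS p01 => t /andP[].
have e50 : 0 < eps / 5 by rewrite divr_gt0.
have dp0 : 0 < 1 + delta by lra.
have dm0 : 0 < 1 - delta by lra.
have [K1 K10 H1] := count_atypical indep tauE p0 (tauW _ dp0) (powR_ge0 _ _)
  eta0 e50.
have [K2 K20 H2] := count_atypical indep tauE p0 (tauW _ dm0) (powR_ge0 _ _)
  eta0 e50.
have [K3 K30 H3] := excess_atypical indep tauE fin p0 W0 a1 ltr01 tauW hW
  eta0 e50.
have [K4 K40 H4] := excess_atypical indep tauE fin p0 W0 a1 dp0 tauW hW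
  eta0 e50.
have [K5 K50 H5] := mean_atypical indep tauE fin p01 eta0 e50.
exists (K1 + K2 + K3 + K4 + K5); first by lra.
near=> t => n Kn.
have := (near H1 t) _ n; have := (near H2 t) _ n; have := (near H3 t) _ n.
have := (near H4 t) _ n; have := (near H5 t) _ n.
move=> /(_ ltac:(by []) ltac:(lra)) B5 /(_ ltac:(by []) ltac:(lra)) B4.
move=> /(_ ltac:(by []) ltac:(lra)) B3 /(_ ltac:(by []) ltac:(lra)) B2.
move=> /(_ ltac:(by []) ltac:(lra)) B1.
rewrite mul1r in B3.
have mI a : measurable_fun setT (fun y : R => (a < y)%R%:R : R).
  exact: measurable_gt_nat.
have mE a : measurable_fun setT (fun y : R => Num.max 0 (y - a)).
  exact: measurable_excess.
have [m1 s1] := sum_dist_ge_measurable X n (n%:R * tau ((1 + delta) * W t))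
  (n%:R * (eta * p t)) (mI ((1 + delta) * W t)).
have [m2 s2] := sum_dist_ge_measurable X n (n%:R * tau ((1 - delta) * W t))
  (n%:R * (eta * p t)) (mI ((1 - delta) * W t)).
have [m3 s3] := sum_dist_ge_measurable X n (n%:R * h (W t))
  (n%:R * (eta * p t * W t)) (mE (W t)).
have [m4 s4] := sum_dist_ge_measurable X n (n%:R * h ((1 + delta) * W t))
  (n%:R * (eta * p t * W t)) (mE ((1 + delta) * W t)).
have [m5 s5] := sum_dist_ge_measurable X n (n%:R * h 0)
  (n%:R * eta) (mE 0).
set A1 := [set z | _] in B1 m1 s1; set A2 := [set z | _] in B2 m2 s2.
set A3 := [set z | _] in B3 m3 s3; set A4 := [set z | _] in B4 m4 s4.
set A5 := [set z | _] in B5 m5 s5.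
exists (A1 `|` A2 `|` A3 `|` A4 `|` A5); split.
- by do 4 apply: measurableU => //.
- pose S := g_sigma_algebraType (\bigcup_(i in [set: nat])
    preimage_set_system setT (X i : T -> R) measurable).
  by do 4 (apply: (@measurableU _ S) => //).
- have e5 : eps = eps / 5 + eps / 5 + eps / 5 + eps / 5 + eps / 5 by field.
  rewrite e5 !EFinD.
  apply: le_trans (measureU2 _ _ m5) _; first by do 3 apply: measurableU => //.
  apply: leeD => //.
  apply: le_trans (measureU2 _ _ m4) _; first by do 2 apply: measurableU => //.
  apply: leeD => //.
  apply: le_trans (measureU2 _ _ m3) _; first by apply: measurableU.
  apply: leeD => //.
  by apply: le_trans (measureU2 _ m1 m2) _; apply: leeD.
- move=> z nB; split; rewrite ltNge; apply/negP => H; apply: nB.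
  + by do 4 left.
  + by do 3 left; right.
  + by do 2 left; right.
  + by left; right.
  + by right.
Unshelve. all: by end_near. Qed.

(** Splitting by the value of N replaces conditioning: the probability is at most the sum of P(N =
    n) P(B n). *)
Lemma independent_mixture_le d (T : measurableType d) (R : realType)
    (P : probability T R) (N : {RV P >-> nat}) (B : nat -> set T) (eps : R) :
  (forall n, measurable (B n)) ->
  (forall n, P (N @^-1` [set n] `&` B n) = (P (N @^-1` [set n]) * P (B n))%E) ->
  (forall n, (P (B n) <= eps%:E)%E) -> 0 <= eps ->
  measurable (\bigcup_n (N @^-1` [set n] `&` B n)) /\
  (P (\bigcup_n (N @^-1` [set n] `&` B n)) <= eps%:E)%E.
Proof.
move=> mB indep Beps eps0.
have mN n : measurable (N @^-1` [set n]) by exact: measurable_funPTI.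
have mNB n : measurable (N @^-1` [set n] `&` B n) by exact: measurableI.
split; first exact: bigcup_measurable.
apply: (@le_trans _ _ (\sum_(0 <= n <oo) P (N @^-1` [set n] `&` B n))%E).
  by apply: measure_sigma_subadditive => //; exact: bigcup_measurable.
apply: (@le_trans _ _ (\sum_(0 <= n <oo) (eps%:E * P (N @^-1` [set n])))%E).
  by apply: lee_nneseries => // n _; rewrite indep [leLHS]muleC lee_wpmul2r.
rewrite nneseriesZl//.
have -> : (\sum_(0 <= n <oo) P (N @^-1` [set n]) = P setT)%E.
  have <- : \bigcup_n (N @^-1` [set n]) = setT.
    by apply/seteqP; split => // z _; exists (N z).
  rewrite measure_bigcup//; last first.
    by move=> i j _ _ [z [/= <- <-]].
  by apply: eq_eseriesl => n; rewrite in_setT.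
by rewrite probability_setT mule1.
Qed.

(** * Convergence in distribution along a curve *)

(* The integral of a nonnegative function is a supremum over the simple functions
   below it, so u and v need not be measurable; this spares proving that the
   order statistics are random variables. *)
Lemma ge0_le_integral_nonmeasurable d (T : measurableType d) (R : realType)
    (P : {measure set T -> \bar R}) (u v : T -> \bar R) :
  (forall z, 0 <= u z)%E -> (forall z, u z <= v z)%E ->
  (\int[P]_z u z <= \int[P]_z v z)%E.
Proof.
move=> u0 uv; rewrite !ge0_integralTE//; last by move=> z; exact: le_trans (uv z).
apply: ereal_sup_le => _ [k /= ku <-]; exists k => //= z.
exact: le_trans (uv z).
Qed.

(** [u] will be built from order statistics and is not assumed measurable. It is enclosed between
    the measurable functions (g - k)^+ and g + k, where [k] is [e] plus [M] times the indicator of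
    [D]. *)
Lemma ge0_integral_dist d (T : measurableType d) (R : realType)
    (P : probability T R) (u g : T -> R) (M e : R) (D : set T) :
  0 <= e -> measurable_fun setT g -> measurable D ->
  (forall z, 0 <= u z <= M) -> (forall z, 0 <= g z <= M) ->
  (forall z, ~ D z -> `|u z - g z| <= e) ->
  [/\ (\int[P]_z (u z)%:E)%E \is a fin_num,
      (\int[P]_z (g z)%:E)%E \is a fin_num &
      `|fine (\int[P]_z (u z)%:E)%E - fine (\int[P]_z (g z)%:E)%E| <=
        e + M * fine (P D)].
Proof.
move=> e0 mg mD uM gM ug.
have M0 : 0 <= M.
  have [T0|/set0P[z _]] := eqVneq [set: T] set0.
    have := probability_setT P; rewrite T0 measure0 => /esym/eqP.
    by rewrite eqe oner_eq0.
  by case/andP: (uM z) => /le_trans; exact.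
pose k z := e + M * \1_D z.
have mk : measurable_fun setT k by apply: measurable_funD => //; apply: measurable_funM.
have k0 z : 0 <= k z by rewrite addr_ge0 ?mulr_ge0.
have kE : (\int[P]_z (k z)%:E = (e + M * fine (P D))%:E)%E.
  under eq_integral do rewrite EFinD.
  rewrite ge0_integralD//.
  - rewrite integral_cst//= probability_setT mule1 EFinD; congr (_ + _)%E.
    under eq_integral do rewrite EFinM.
    rewrite ge0_integralZl_EFin//.
    + by rewrite integral_indic// setIT EFinM fineK// fin_num_measure.
    + exact/measurable_EFinP.
  - by move=> z _; rewrite lee_fin mulr_ge0.
  - by apply/measurable_EFinP; apply: measurable_funM.
have ugk z : u z <= g z + k z /\ g z <= u z + k z.
  have [Dz|nDz] := pselect (D z); rewrite /k indicE.
    rewrite mem_set// mulr1; move: (uM z) (gM z) => /andP[? ?] /andP[? ?]; split; lra.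
  rewrite memNset// mulr0 addr0; move: (ug z nDz); rewrite ler_distl => /andP[? ?].
  by split; lra.
have fin (w : T -> R) : (forall z, 0 <= w z <= M) ->
    (\int[P]_z (w z)%:E)%E \is a fin_num.
  move=> wM; rewrite ge0_fin_numE; last first.
    by apply: integral_ge0 => z _; rewrite lee_fin; case/andP: (wM z).
  apply: (@le_lt_trans _ _ (\int[P]_z M%:E)%E).
    by apply: ge0_le_integral_nonmeasurable => z; rewrite lee_fin; case/andP: (wM z).
  by rewrite integral_cst//= probability_setT mule1 ltry.
have gfin := fin g gM; have ufin := fin u uM; split=> //.
rewrite ler_distl; apply/andP; split.
  rewrite lerBlDr -lee_fin EFinD -kE !fineK//.
  (* Additivity of the integral is applied to measurable functions only; hence the detour through
     [w], with g <= w + k and w <= u. *)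
  pose w z := Num.max 0 (g z - k z).
  have mw : measurable_fun setT w.
    by apply: measurable_maxr => //; exact: measurable_funB.
  apply: (@le_trans _ _ (\int[P]_z (w z)%:E + \int[P]_z (k z)%:E)%E).
    rewrite -ge0_integralD//.
    - apply: ge0_le_integral_nonmeasurable => z.
        by rewrite lee_fin; case/andP: (gM z).
      by rewrite -EFinD lee_fin -lerBlDr le_max lexx orbT.
    - by move=> z _; rewrite lee_fin le_max lexx.
    - exact/measurable_EFinP.
    - by move=> z _; rewrite lee_fin.
    - exact/measurable_EFinP.
  apply: leeD => //; apply: ge0_le_integral_nonmeasurable => z.
    by rewrite lee_fin le_max lexx.
  rewrite lee_fin ge_max; case/andP: (uM z) => -> _ /=.
  by rewrite lerBlDr; case: (ugk z).
rewrite -lee_fin EFinD -kE !fineK//.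
rewrite -ge0_integralD//.
- apply: ge0_le_integral_nonmeasurable => z.
    by rewrite lee_fin; case/andP: (uM z).
  by rewrite -EFinD lee_fin; case: (ugk z).
- by move=> z _; rewrite lee_fin; case/andP: (gM z).
- exact/measurable_EFinP.
- by move=> z _; rewrite lee_fin.
- exact/measurable_EFinP.
Qed.

(** The expectation is the difference of the integrals of the positive and negative parts; taking
    either part is 1-Lipschitz, and the nonnegative case used twice gives the factor 2. *)
Lemma expectation_dist d (T : measurableType d) (R : realType)
    (P : probability T R) (u g : T -> R) (M e : R) (D : set T) :
  0 <= e -> measurable_fun setT g -> measurable D ->
  (forall z, `|u z| <= M) -> (forall z, `|g z| <= M) ->
  (forall z, ~ D z -> `|u z - g z| <= e) ->
  [/\ 'E_P[u]%E \is a fin_num, 'E_P[g]%E \is a fin_num &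
      `|fine 'E_P[u]%E - fine 'E_P[g]%E| <= 2 * (e + M * fine (P D))].
Proof.
move=> e0 mg mD uM gM ug.
have posE (w : T -> R) z : ((EFin \o w)^\+ z = (Num.max (w z) 0)%:E)%E.
  by rewrite funeposE /= EFin_max.
have negE (w : T -> R) z : ((EFin \o w)^\- z = (Num.max (- w z) 0)%:E)%E.
  by rewrite funenegE /= EFin_max.
have bd (w : R) : `|w| <= M -> 0 <= Num.max w 0 <= M.
  rewrite ler_norml => /andP[? ?].
  by rewrite le_max lexx orbT/= ge_max; apply/andP; split=> //; lra.
have dist (v w : R) : `|v - w| <= e -> `|Num.max v 0 - Num.max w 0| <= e.
  rewrite !ler_distl => /andP[? ?].
  by have [|] := leP v 0; have [|] := leP w 0 => ? ?; apply/andP; split; lra.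
have [f1 f2 d1] := @ge0_integral_dist _ _ _ P (fun z => Num.max (u z) 0)
  (fun z => Num.max (g z) 0) M e D e0 (measurable_maxr mg (measurable_cst _)) mD
  (fun z => bd _ (uM z)) (fun z => bd _ (gM z)) (fun z nD => dist _ _ (ug z nD)).
have mNg : measurable_fun setT (fun z => Num.max (- g z) 0).
  by apply: measurable_maxr => //; exact: measurable_funN.
have [|||f3 f4 d2] := @ge0_integral_dist _ _ _ P (fun z => Num.max (- u z) 0)
  (fun z => Num.max (- g z) 0) M e D e0 mNg mD.
- by move=> z; apply: bd; rewrite normrN.
- by move=> z; apply: bd; rewrite normrN.
- by move=> z nD; apply: dist; rewrite -opprD normrN; exact: ug.
have EE (w : T -> R) : ('E_P[w] = \int[P]_z (Num.max (w z) 0)%:E -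
    \int[P]_z (Num.max (- w z) 0)%:E)%E.
  rewrite unlock integralE; congr (_ - _)%E; apply: eq_integral => z _.
    by rewrite -posE.
  by rewrite -negE.
rewrite !EE; split; first by rewrite fin_numB f1.
  by rewrite fin_numB f2.
rewrite (fineB f1 f3) (fineB f2 f4).
move: d1 d2; rewrite !ler_distl => /andP[? ?] /andP[? ?].
by apply/andP; split; lra.
Qed.

(** [f] need not be uniformly continuous on the whole space, but it is so around the compact arc 0
    <= th <= K. *)
Lemma compact_curve_unif (R : realType) (f : R * R * R -> R) (a b K e : R) :
  continuous f -> 0 < e ->
  exists2 r, 0 < r & forall th y, 0 <= th <= K ->
    `|y.1.1 - a * th| <= r -> `|y.1.2 - 1| <= r -> `|y.2 - b * th| <= r ->
    `|f y - f (a * th, 1, b * th)| <= e.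
Proof.
move=> cf e0.
(* In near-covering form, a radius valid near each [th0] yields one valid on the whole segment. *)
have /compact_near_coveringP cov := @segment_compact R 0 K.
pose Q (r th : R) := forall y : R * R * R,
    `|y.1.1 - a * th| <= r -> `|y.1.2 - 1| <= r -> `|y.2 - b * th| <= r ->
    `|f y - f (a * th, 1, b * th)| <= e.
have [] := cov R (0^'+ : set_system R) Q _; last first.
  move=> r /= r0 H; exists (r / 2); first by rewrite divr_gt0.
  have r20 : 0 < r / 2 by rewrite divr_gt0.
  have r2r : ball 0 r (r / 2).
    rewrite /ball/= sub0r normrN gtr0_norm//.
    by rewrite gtr_pMr// invf_lt1// ltr1n.
  move=> th y thK; apply: (H _ r2r r20).
  by rewrite /= in_itv.
move=> th0 _.
have e20 : 0 < e / 2 by rewrite divr_gt0.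
have [r /= r0 Hr] : exists2 r, 0 < r & forall y : R * R * R,
    `|y.1.1 - a * th0| < r -> `|y.1.2 - 1| < r -> `|y.2 - b * th0| < r ->
    `|f (a * th0, 1, b * th0) - f y| <= e / 2.
  have /cvgrPdist_le /(_ _ e20) /nbhs_ballP [r /= r0 H] := cf (a * th0, 1, b * th0).
  exists r => // y y1 y2 y3; apply: H.
  by split; [split|]; rewrite /ball/= /ball_/= distrC.
(* Moving the parameter by less than [rho] moves each coordinate of the curve by less than r/2,
   which leaves r/2 for [y]. *)
pose rho := r / 2 / (`|a| + `|b| + 1).
have ab0 : 0 < `|a| + `|b| + 1 by rewrite ltr_wpDl// addr_ge0.
have rho0 : 0 < rho by rewrite !divr_gt0.
exists (ball th0 rho, [set x | x < r / 2] : set R) => /=.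
  split; first exact: nbhsx_ballx.
  by apply: nbhs_right_lt; rewrite divr_gt0.
move=> [th q] /= [thb qr] y y1 y2 y3.
have close (c : R) : `|c| <= `|a| + `|b| + 1 -> `|c * th - c * th0| < r / 2.
  move=> cab; rewrite -mulrBr normrM distrC.
  have thr : `|th0 - th| < rho by [].
  apply: (@le_lt_trans _ _ ((`|a| + `|b| + 1) * `|th0 - th|)).
    by rewrite ler_wpM2r.
  by rewrite mulrC -ltr_pdivlMr.
have ca := close a ltac:(by rewrite -addrA lerDl addr_ge0).
have cb := close b ltac:(by rewrite addrAC lerDr addr_ge0).
have r20 : 0 < r / 2 by rewrite divr_gt0.
have t1 : `|f (a * th0, 1, b * th0) - f y| <= e / 2.
  apply: Hr; move: y1 y2 y3 ca cb; rewrite !(ler_distl, ltr_distl) => 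
    /andP[? ?] /andP[? ?] /andP[? ?] /andP[? ?] /andP[? ?]; apply/andP; split; lra.
have t2 : `|f (a * th0, 1, b * th0) - f (a * th, 1, b * th)| <= e / 2.
  apply: Hr => /=; rewrite ?subrr ?normr0//.
    by apply: lt_trans ca _; lra.
  by apply: lt_trans cb _; lra.
by move: t1 t2; rewrite !ler_distl => /andP[? ?] /andP[? ?]; apply/andP; split; lra.
Qed.

(** The continuous function [cut] lies between the indicators of x > K0 + 1 and x > K0, so it
    carries a tail bound from [Z] over to [V t]. *)
Lemma cvg_in_distribution_tight (R : realType) d (T : measurableType d)
    (P : probability T R) (V : R -> T -> R)
    d' (T' : measurableType d') (Q : probability T' R) (Z : {RV Q >-> R})
    (eps : R) :
  (forall t, measurable_fun setT (V t)) -> cvg_in_distribution P V Q Z ->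
  0 < eps ->
  exists K, \forall t \near +oo, (P [set z | (K < V t z)%R] <= eps%:E)%E.
Proof.
move=> mV cvgV eps0.
have [K0 HK0] : exists K, (Q [set z | (K < Z z)%R] <= (eps / 2)%:E)%E.
  have e20 : 0 < eps / 2 by rewrite divr_gt0.
  have /fine_cvgP[_ /cvgrPdist_le /(_ _ e20)[x [_ H]]] := cvg_ccdfy0 Z.
  exists (x + 1).
  have := H (x + 1); rewrite ltrDl ltr01 => /(_ isT).
  rewrite sub0r normrN ger0_norm ?fine_ge0// => Hx.
  have -> : [set z | x + 1 < Z z] = Z @^-1` `]x + 1, +oo[.
    by apply/seteqP; split => z /=; rewrite in_itv/= andbT.
  by rewrite -(fineK (fin_num_measure _ _ _)) ?lee_fin//; exact: measurable_funPTI.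
pose cut (x : R) := Num.min 1 (Num.max 0 (x - K0)).
have cut01 x : 0 <= cut x <= 1.
  by rewrite /cut le_min ge_min le_max !lexx ler01.
have ccut : continuous cut.
  move=> x; apply: (@continuous_min R R (cst 1) (fun y => Num.max 0 (y - K0))).
    exact: cvg_cst.
  apply: (@continuous_max R R (cst 0) (fun y => y - K0)); first exact: cvg_cst.
  by apply: (@cvgB _ R); [exact: cvg_id|exact: cvg_cst].
have mcut : measurable_fun setT cut by exact: continuous_measurable_fun.
have bcut : exists M : R, forall x, `|cut x| <= M.
  by exists 1 => x; case/andP: (cut01 x) => c0 c1; rewrite ger0_norm.
have EZ0 : (0 <= 'E_Q[cut \o Z])%E.
  by apply: expectation_ge0 => z; case/andP: (cut01 (Z z)).
have EZ : ('E_Q[cut \o Z] <= (eps / 2)%:E)%E.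
  apply: le_trans HK0; rewrite unlock -[leRHS]mul1e -integral_gt_nat//.
  apply: ge0_le_integral => //.
  - by move=> z _; rewrite lee_fin; case/andP: (cut01 (Z z)).
  - by apply/measurable_EFinP; exact: measurableT_comp.
  - apply/measurable_EFinP; apply: measurable_funM => //.
    exact: measurable_gt_nat.
  - move=> z _; rewrite lee_fin mul1r /=.
    have [KZ|ZK] := ltP K0 (Z z); first by case/andP: (cut01 (Z z)).
    by rewrite /cut (@max_l _ _ 0 (Z z - K0)) ?subr_le0// min_r// ler01.
have EZfin : ('E_Q[cut \o Z])%E \is a fin_num.
  by rewrite ge0_fin_numE// (le_lt_trans EZ)// ltry.
have := cvgV cut ccut bcut; rewrite -(fineK EZfin) => /fine_cvgP[Efin Ecvg].
have Elt : fine ('E_Q[cut \o Z])%E < eps.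
  apply: (@le_lt_trans _ _ (eps / 2)); last by rewrite gtr_pMr// invf_lt1// ltr1n.
  by rewrite -lee_fin fineK.
exists (K0 + 1); near=> t.
have Et : ('E_P[cut \o V t])%E \is a fin_num by near: t.
have : fine ('E_P[cut \o V t])%E < eps.
  by near: t; exact: (cvgr_lt _ Ecvg).
move=> /ltW; rewrite -lee_fin fineK//; apply: le_trans.
rewrite unlock -[leLHS]mul1e -integral_gt_nat//.
apply: ge0_le_integral => //.
- apply/measurable_EFinP; apply: measurable_funM => //.
  exact: measurable_gt_nat.
- by apply/measurable_EFinP; exact: measurableT_comp.
- move=> z _; rewrite lee_fin mul1r /=.
  have [KV|_] := ltP (K0 + 1) (V t z); last by case/andP: (cut01 (V t z)).
  rewrite /cut max_r ?subr_ge0; last by lra.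
  by rewrite min_l// lerBrDl ltW.
Unshelve. all: by end_near. Qed.

(** A test function composed with the curve is a test function for V. The allowed errors are
    proportional to V, so they become small where tightness bounds V, and there the curve stays in a
    compact arc. *)
Lemma cvg_in_distribution_curve (R : realType) d (T : measurableType d)
    (P : probability T R) (Y : R -> T -> R * R * R) (V : R -> T -> R)
    d' (T' : measurableType d') (Q : probability T' R) (Z : {RV Q >-> R})
    (a b : R) :
  (forall t, measurable_fun setT (V t)) ->
  (\forall t \near +oo, forall z, 0 <= V t z) ->
  cvg_in_distribution P V Q Z ->
  (forall eps : R, 0 < eps -> \forall t \near +oo, exists D,
    [/\ measurable D, (P D <= eps%:E)%E & forall z, ~ D z ->
      [/\ `|(Y t z).1.1 - a * V t z| <= eps * V t z,
          `|(Y t z).1.2 - 1| <= eps &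
          `|(Y t z).2 - b * V t z| <= eps * V t z]]) ->
  cvg_in_distribution P Y Q (fun z => (a * Z z, 1, b * Z z)).
Proof.
move=> mV V0 cvgV near_curve f cf [M fM].
pose g th := f (a * th, 1, b * th).
have cg : continuous g.
  move=> th; apply: (@continuous_comp _ _ _
    (fun th : R => (a * th, 1 : R, b * th)) f); last exact: cf.
  have cM (c : R) : c * x @[x --> th] --> c * th by exact: mulrl_continuous.
  have c1 : (1 : R) @[x --> th] --> (1 : R) by exact: cvg_cst.
  exact: (cvg_pair (cvg_pair (cM a) c1) (cM b)).
have mg : measurable_fun setT g by exact: continuous_measurable_fun.
have gM th : `|g th| <= M by exact: fM.
have M0 : 0 <= M := le_trans (normr_ge0 _) (gM 0).
have cvg_g := cvgV g cg (ex_intro _ M gM).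
have gZfin : ('E_Q[g \o Z])%E \is a fin_num.
  (* Comparing the function with itself extracts the finiteness of its expectation. *)
  have [||||] := @expectation_dist _ _ _ Q (g \o Z) (g \o Z) M 0
    set0 (lexx 0) _ measurable0.
  - exact: measurableT_comp.
  - by move=> z; exact: gM.
  - by move=> z; exact: gM.
  - by move=> z _ /=; rewrite subrr normr0.
  - by [].
move: cvg_g; rewrite -(fineK gZfin) => /fine_cvgP[_ /cvgrPdist_le cvg_g].
have main (e : R) : 0 < e -> \forall t \near +oo,
    ('E_P[f \o Y t])%E \is a fin_num /\
    `|fine ('E_P[f \o Y t])%E - fine ('E_P[g \o V t])%E| <= e.
  move=> e0.
  (* Solves 2 (e1 + 2 M e1) = e: [D] and the event V > K0 have probability at most [e1] each. *)
  pose e1 := e / (2 * (1 + 2 * M)).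
  have D0 : 0 < 2 * (1 + 2 * M) by lra.
  have e10 : 0 < e1 by rewrite divr_gt0.
  have [K0 tight] := cvg_in_distribution_tight mV cvgV e10.
  pose K := Num.max K0 0.
  have K_ge0 : 0 <= K by rewrite le_max lexx orbT.
  have [r r0 Hr] := compact_curve_unif a b K cf e10.
  (* The three terms bound P(D) by [e1], the error of the middle coordinate by [r], and the relative
     errors by [r] when V <= K. *)
  pose eps := Num.min e1 (Num.min r (r / (K + 1))).
  have K10 : 0 < K + 1 by lra.
  have eps0 : 0 < eps by rewrite !lt_min e10 r0 divr_gt0.
  near=> t.
  have V0t z : 0 <= V t z by move: z; near: t.
  have [D [mD PD HD]] : exists D,
    [/\ measurable D, (P D <= eps%:E)%E & forall z, ~ D z ->
      [/\ `|(Y t z).1.1 - a * V t z| <= eps * V t z,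
          `|(Y t z).1.2 - 1| <= eps &
          `|(Y t z).2 - b * V t z| <= eps * V t z]].
    by near: t; exact: near_curve.
  pose B := [set z | K0 < V t z].
  have mB : measurable B by exact: measurable_gt.
  have PB : (P B <= e1%:E)%E by rewrite /B; near: t.
  have close z : ~ (D `|` B) z -> `|(f \o Y t) z - (g \o V t) z| <= e1.
    move=> nDB; have [] := HD z (fun h => nDB (or_introl h)).
    have VK : V t z <= K.
      rewrite le_max leNgt; apply/orP; left; apply/negP => h.
      by apply: nDB; right.
    have epsV : eps * V t z <= r.
      apply: (@le_trans _ _ (r / (K + 1) * (K + 1))).
        by apply: ler_pM => //; [exact: ltW|rewrite !ge_min lexx !orbT|lra].
      by rewrite divfK ?gt_eqF.
    move=> h1 h2 h3; apply: Hr.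
    - by rewrite V0t VK.
    - exact: le_trans h1 epsV.
    - by apply: le_trans h2 _; rewrite !ge_min lexx orbT.
    - exact: le_trans h3 epsV.
  have mgV : measurable_fun setT (g \o V t) by exact: measurableT_comp.
  have [ffin _ dist] := @expectation_dist _ _ _ P (f \o Y t) (g \o V t) M e1
    (D `|` B) (ltW e10) mgV (measurableU _ _ mD mB) (fun z => fM _)
    (fun z => gM _) close.
  split=> //; apply: le_trans dist _.
  have PDB : fine (P (D `|` B)) <= 2 * e1.
    rewrite -lee_fin fineK ?fin_num_measure//; last exact: measurableU.
    apply: le_trans (measureU2 _ mD mB) _.
    have -> : 2 * e1 = e1 + e1 by ring.
    rewrite EFinD; apply: leeD => //; apply: le_trans PD _.
    by rewrite lee_fin ge_min lexx.
  apply: (@le_trans _ _ (2 * (e1 + M * (2 * e1)))).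
    by rewrite ler_pM2l// lerD2l ler_wpM2l.
  by rewrite le_eqVlt /e1; apply/orP; left; apply/eqP; field; rewrite gt_eqF//; lra.
apply/fine_cvgP; split.
  by have := main 1 ltr01; apply: filterS => t [].
apply/cvgrPdist_le => e e0.
have e20 : 0 < e / 2 by rewrite divr_gt0.
have Hm := main _ e20; have Hg := cvg_g _ e20.
near=> t.
have [_ h1] : ('E_P[f \o Y t])%E \is a fin_num /\
    `|fine ('E_P[f \o Y t])%E - fine ('E_P[g \o V t])%E| <= e / 2.
  by near: t.
have h2 : `|fine ('E_Q[g \o Z])%E - fine ('E_P[g \o V t])%E| <= e / 2.
  by near: t; exact: Hg.
move: h1 h2; rewrite /= !ler_distl => /andP[? ?] /andP[? ?].
by apply/andP; split; lra.
Unshelve. all: by end_near. Qed.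

(** * The theorem *)

Lemma mutually_pairwise_independent d (T : measurableType d) (R : realType)
    (P : probability T R) (X : nat -> T -> R) :
  mutually_independent P X -> pairwise_independent P X.
Proof.
move=> indep i j A B ij mA mB.
pose C k := if k == i then A else B.
have ji : (j == i) = false by rewrite eq_sym; exact/negbTE.
have := indep [fset i; j]%fset C.
rewrite big_fsetU1/= ?inE// big_seq_fset1 /C eqxx ji => <-; last first.
  by move=> k _; case: ifP.
congr (P _); apply/seteqP; split => z /=.
  by move=> [Az Bz] k; rewrite /= !inE => /orP[|] /eqP->; rewrite ?eqxx ?ji.
move=> H; split.
  by have := H i; rewrite /= !inE !eqxx/=; exact.
by have := H j; rewrite /= !inE !eqxx orbT/= ji; exact.
Qed.

Lemma regularly_varying_tail (R : realType) (tau ell : R -> R) (alpha : R) :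
  slowly_varying ell ->
  (forall x, 0 < x -> tau x = x `^ (- alpha) * ell x) ->
  forall a, 0 < a -> tau (a * x) / tau x @[x --> +oo] --> a `^ (- alpha).
Proof.
move=> [_ ell0 ellRV] tauE a a0.
have H : a `^ (- alpha) * (ell (a * x) / ell x) @[x --> +oo] -->
    a `^ (- alpha) * 1 by exact: cvgMl_tmp (ellRV _ a0).
rewrite mulr1 in H; apply: cvg_trans H; apply: near_eq_cvg; near=> x.
have x0 : 0 < x by near: x; exact/nbhs_pinfty_gt/num_real.
have lx : 0 < ell x by near: x.
rewrite !tauE ?mulr_gt0// powRM ?(ltW a0) ?(ltW x0)//; field.
by rewrite !gt_eqF ?powR_gt0.
Unshelve. all: by end_near. Qed.

(** [ell] is known to be positive only far out; monotonicity carries positivity of the tail back to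
    every [x]. *)
Lemma regularly_varying_tail_gt0 (R : realType) (tau ell : R -> R) (alpha : R) :
  slowly_varying ell ->
  (forall x, 0 < x -> tau x = x `^ (- alpha) * ell x) ->
  (forall x y, x <= y -> tau y <= tau x) -> forall x, 0 < tau x.
Proof.
move=> [_ [y [_ ell0]] _] tauE tau_ni x.
pose w := Num.max (Num.max x (y + 1)) 1.
have xw : x <= w by rewrite !le_max lexx.
have yw : y < w by rewrite !lt_max ltrDl ltr01 orbT.
have w0 : 0 < w by rewrite !lt_max ltr01 orbT.
by apply: lt_le_trans (tau_ni _ _ xw); rewrite tauE// mulr_gt0 ?powR_gt0// ell0.
Qed.

Lemma tail_cdf d (T : measurableType d) (R : realType) (P : probability T R)
    (X : {RV P >-> R}) (F : R -> R) :
  (forall x, cdf X x = (F x)%:E) ->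
  forall a, P [set z | a < X z] = (1 - F a)%:E.
Proof.
move=> XF a; rewrite EFinB -XF -ccdf_1_cdf /ccdf /distribution /pushforward.
by congr (P _); apply/seteqP; split => z /=; rewrite in_itv/= andbT.
Qed.

Lemma joint_laplace_curve d (T : measurableType d) (R : realType)
    (P : probability T R) (Theta : {RV P >-> R}) (a b u v w : R) :
  joint_laplace_transform P (fun z => a * Theta z) (cst 1)
    (fun z => b * Theta z) u v w =
  ((expR (- v))%:E * laplace_transform P Theta (u * a + w * b))%E.
Proof.
rewrite /joint_laplace_transform /laplace_transform unlock.
rewrite -ge0_integralZl_EFin ?expR_ge0//.
- apply: eq_integral => z _; rewrite -EFinM -expRD; congr (expR _)%:E => /=.
  by ring.
- apply/measurable_EFinP; apply: measurableT_comp => //.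
  by apply: measurable_funN; exact: measurable_funM.
Qed.

Lemma laplace_transform_one d (T : measurableType d) (R : realType)
    (P : probability T R) (Theta : {RV P >-> R}) (c : R) :
  {ae P, forall z, Theta z = 1} ->
  laplace_transform P Theta c = (expR (- c))%:E.
Proof.
move=> Theta1; rewrite /laplace_transform unlock.
transitivity (\int[P]_z (expR (- c))%:E)%E; last first.
  by rewrite integral_cst//= probability_setT mule1.
apply: ge0_ae_eq_integral => //.
- apply/measurable_EFinP; apply: measurableT_comp => //.
  by apply: measurable_funN; exact: measurable_funM.
- by apply: filterS Theta1 => z -> _; rewrite mulr1.
Qed.

Lemma exceptional_event d (T : measurableType d) (R : realType)
    (P : probability T R) (X : nat -> T -> R) (N : R -> {RV P >-> nat})
    (p : R -> R) (Typ : R -> nat -> T -> Prop) (K eps : R) :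
  independent_sigma_algebras P
    (sigma_algebra_of_family [set t : R | 0 <= t] (fun t : R => N t : T -> nat))
    (sigma_algebra_of_family setT X) ->
  diverges_in_probability P (fun t z => Num.truncn (p t * (N t z)%:R)) ->
  0 < eps ->
  (\forall t \near +oo, forall n, K <= p t * n%:R -> exists B, [/\ measurable B,
    sigma_algebra_of_family setT X B, (P B <= (eps / 2)%:E)%E &
    forall z, ~ B z -> Typ t n z]) ->
  \forall t \near +oo, exists D, [/\ measurable D, (P D <= eps%:E)%E &
    forall z, ~ D z -> K <= p t * (N t z)%:R /\ Typ t (N t z) z].
Proof.
move=> indep s_cvgy eps0 typ.
have e20 : 0 < eps / 2 by rewrite divr_gt0.
(* If [s] is at least [k], then p(t) N(t) >= k > K. *)
pose k := (Num.truncn K).+1.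
have kK : K < k%:R by exact: truncnS_gt.
have small : \forall t \near +oo,
    (P [set z | (Num.truncn (p t * (N t z)%:R) < k)%N] <= (eps / 2)%:E)%E.
  have /fine_cvgP[fin] := s_cvgy k.
  move=> /cvgr_le /(_ _ e20) H; near=> t.
  have fint : P [set z | (Num.truncn (p t * (N t z)%:R) < k)%N] \is a fin_num.
    by near: t.
  by rewrite -(fineK fint) lee_fin; near: t.
near=> t.
have t0 : 0 <= t by near: t; exact/nbhs_pinfty_ge/num_real.
have typt : forall n, K <= p t * n%:R -> exists B, [/\ measurable B,
    sigma_algebra_of_family setT X B, (P B <= (eps / 2)%:E)%E &
    forall z, ~ B z -> Typ t n z] by near: t.
pose S := g_sigma_algebraType (\bigcup_(i in [set: nat])
  preimage_set_system setT (X i) measurable).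
have /choice[B HB] : forall n, exists B, [/\ measurable B,
    sigma_algebra_of_family setT X B, (P B <= (eps / 2)%:E)%E &
    K <= p t * n%:R -> forall z, ~ B z -> Typ t n z].
  move=> n; have [Kn|Kn] := leP K (p t * n%:R).
    by have [B [? ? ? ?]] := typt n Kn; exists B.
  (* Sizes below the range are covered by the event that [s] is less than [k], so they contribute
     nothing here. *)
  exists set0; split=> //; first exact: (@measurable0 _ S).
  by rewrite measure0 lee_fin ltW.
have NB n : P (N t @^-1` [set n] `&` B n) =
    (P (N t @^-1` [set n]) * P (B n))%E.
  apply: indep; last by case: (HB n).
  apply: sub_sigma_algebra; exists t => //=; exists [set n] => //.
  by rewrite setTI.
have [|||mU PU] := @independent_mixture_le _ _ _ P (N t) B (eps / 2) _ NB.
- by move=> n; case: (HB n).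
- by move=> n; case: (HB n).
- exact: ltW.
pose A := [set z | (Num.truncn (p t * (N t z)%:R) < k)%N].
have mA : measurable A.
  have := measurable_funPTI (N t)
    (I : measurable [set n | (Num.truncn (p t * n%:R) < k)%N]).
  by [].
have PA : (P A <= (eps / 2)%:E)%E by rewrite /A; near: t.
exists (A `|` \bigcup_n (N t @^-1` [set n] `&` B n)); split.
- exact: measurableU.
- apply: le_trans (measureU2 _ mA mU) _.
  by rewrite [in leRHS](splitr eps) EFinD leeD.
- move=> z /not_orP[nA nU].
  have KN : K <= p t * (N t z)%:R.
    apply: le_trans (ltW kK) _; move/negP : nA; rewrite -leqNgt /k.
    by rewrite truncn_gt_nat.
  split=> //; have [_ _ _] := HB (N t z); apply=> // Bz.
  by apply: nU; exists (N t z).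
Unshelve. all: by end_near. Qed.

(* The claim X_i is X i.-1 here. Num.truncn is the floor on nonnegative reals
   (p t is positive for t large). *)
Theorem proposition4p2 (R : realType)
    (d : measure_display) (T : measurableType d) (P : probability T R)
    (X : nat -> {RV P >-> R}) (N : R -> {RV P >-> nat})
    (d' : measure_display) (T' : measurableType d') (P' : probability T' R)
    (Theta : {RV P' >-> R})
    (F ell : R -> R) (alpha : R) (p : R -> R)
    (X_gt0 : forall i z, 0 < X i z)
    (X_indep : mutually_independent P (fun i => X i : T -> R))
    (X_cdf : forall (i : nat) (x : R), cdf (X i) x = (F x)%:E)
    (ell_sv : slowly_varying ell)
    (F_tail : forall x : R, 0 < x -> 1 - F x = x `^ (- alpha) * ell x)
    (alpha_gt1 : 1 < alpha)
    (N_count : forall (z : T) (t1 t2 : R), 0 <= t1 -> t1 <= t2 -> (N t1 z <= N t2 z)%N)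
    (N_X_indep : independent_sigma_algebras P
       (sigma_algebra_of_family [set t : R | 0 <= t] (fun t : R => N t : T -> nat))
       (sigma_algebra_of_family setT (fun i => X i : T -> R)))
    (N_near_mixed_poisson :
       cvg_in_distribution P (fun t z => (N t z)%:R / t : R) P' Theta)
    (p_cvg0 : p t @[t --> +oo] --> (0 : R))
    (tp_cvgy : t * p t @[t --> +oo] --> +oo)
    (s_cvgy : diverges_in_probability P
       (fun t z => Num.truncn (p t * (N t z)%:R))) :
  let gamma : R := alpha^-1 in
  let mu : R := fine ('E_P[X 0%N])%E in
  let U : R -> R := tail_quantile F in
  let s (t : R) (z : T) : nat := Num.truncn (p t * (N t z)%:R) in
  let x (z : T) : nat -> R := fun i => X i z in
  exists (d'' : measure_display) (T'' : measurableType d'')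
      (Q : probability T'' R) (Lambda Xi Sigma : {RV Q >-> R}),
    [/\ cvg_in_distribution P
          (fun t z =>
            (largest_sum (x z) (N t z) (s t z) / (t * p t * U (p t)^-1),
             order_stat (x z) (N t z) (N t z - s t z) / U (p t)^-1,
             smallest_sum (x z) (N t z) (s t z) / t) : R * R * R)
          Q (fun z => (Lambda z, Xi z, Sigma z)),
        forall u v w : R, 0 <= u -> 0 <= v -> 0 <= w ->
          joint_laplace_transform Q Lambda Xi Sigma u v w =
          ((expR (- v))%:E *
             laplace_transform P' Theta (u / (1 - gamma) + w * mu))%E &
        {ae P', forall z, Theta z = 1} ->
        forall u v w : R, 0 <= u -> 0 <= v -> 0 <= w ->
          joint_laplace_transform Q Lambda Xi Sigma u v w =
          (expR (- (u / (1 - gamma))) * expR (- v) * expR (- (w * mu)))%:E].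
Proof.
move=> gamma mu U s x.
pose tau y := 1 - F y.
have tauE i a : P [set z | a < X i z] = (tau a)%:E.
  exact: tail_cdf (X_cdf i) a.
have tau_ni := tail_nonincreasing (tauE 0%N).
have tau0 : forall y, 0 < tau y :=
  regularly_varying_tail_gt0 ell_sv F_tail tau_ni.
have tauRV := regularly_varying_tail ell_sv F_tail.
have F_nd y y' : y <= y' -> F y <= F y'.
  by move=> yy'; have := tau_ni _ _ yy'; rewrite /tau lerD2l lerN2.
have F_lt1 y : F y < 1 by have := tau0 y; rewrite /tau subr_gt0.
have F_cvg1 : F y @[y --> +oo] --> (1 : R).
  have /fine_cvgP[_] := cvg_cdfy1 (X 0%N).
  by under [X in X @ _ --> _]funext do rewrite /= X_cdf /=.
have F_le0 y : y <= 0 -> F y <= 0.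
  move=> y0; rewrite -lee_fin -(X_cdf 0%N) /cdf /distribution /pushforward.
  have -> : X 0%N @^-1` `]-oo, y] = set0.
    apply/seteqP; split => z //=; rewrite in_itv/= => Xy.
    by have := X_gt0 0%N z; rewrite ltNge (le_trans Xy).
  by rewrite measure0.
have fin := mean_excess_fin_num (tauE 0%N) tau0 alpha_gt1 tauRV.
pose h y := fine (mean_excess P (X 0%N) y).
have h_equiv : h y / (y * tau y) @[y --> +oo] --> (alpha - 1)^-1.
  exact: mean_excess_equiv (tauE 0%N) tau0 alpha_gt1 tauRV.
have h_cvg0 : h y @[y --> +oo] --> (0 : R) := mean_excess_cvg0 fin.
have h0E : h 0 = mu.
  rewrite /h /mu unlock; congr fine; apply: eq_integral => z _.
  by rewrite subr0 max_r// ltW.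
have p_gt0 : \forall t \near +oo, 0 < p t.
  near=> t; have tp : 0 < t * p t by near: t; move/cvgryPgt : tp_cvgy; exact.
  have t0 : 0 < t by near: t; exact/nbhs_pinfty_gt/num_real.
  by rewrite -(pmulr_rgt0 _ t0).
have p_lt1 : \forall t \near +oo, p t < 1 by exact: (cvgr_lt _ p_cvg0).
have p01 : \forall t \near +oo, 0 < p t < 1.
  by near=> t; apply/andP; split; near: t.
pose W t := U (p t)^-1.
have Woo : W t @[t --> +oo] --> +oo by exact: quantile_cvgy.
have W_gt0 : \forall t \near +oo, 0 < W t by move/cvgryPgt : Woo; exact.
have alpha0 : 0 < alpha by lra.
have tauW a : 0 < a -> tau (a * W t) / p t @[t --> +oo] --> a `^ (- alpha).
  move=> a0; apply: tail_at_quantile => //.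
    near=> t => y; apply: quantile_lt_tail => //; by near: t.
  near=> t => y; apply: quantile_ge_tail => //.
  have : 1 - p t < 1 by rewrite ltrBlDr ltrDl; near: t.
  move=> /(cvgr_gt _ F_cvg1) [y0 [_ H]]; exists (y0 + 1).
  by apply/ltW/H; rewrite ltrDl.
have hW a : 0 < a -> h (a * W t) / (p t * W t) @[t --> +oo] -->
    (alpha - 1)^-1 * (a * a `^ (- alpha)).
  by move=> a0; apply: (excess_at_quantile (tau := tau)) => //; exact: tauW.
set kappa := (alpha - 1)^-1 in h_equiv hW.
have kappa0 : 0 < kappa by rewrite invr_gt0 subr_gt0.
have hW1 : h (W t) / (p t * W t) @[t --> +oo] --> kappa.
  have := hW 1 ltr01; rewrite powR1 !mulr1.
  by under [X in X @ _ --> _]funext do rewrite mul1r.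
have pW0 : p t * W t @[t --> +oo] --> (0 : R).
  exact: scaled_quantile_cvg0 hW1 _ _.
have indep := mutually_pairwise_independent X_indep.
(* The two sources of Lambda_s: 1 for the level W of each of the [s] largest claims, kappa for their
   excesses over W. *)
have kE : (1 - gamma)^-1 = 1 + kappa.
  by rewrite /gamma /kappa; field; rewrite !gt_eqF// subr_gt0.
pose V t z := (N t z)%:R / t.
have mN t : measurable_fun setT (fun z => (N t z)%:R : R).
  have mnat : measurable_fun setT (fun n : nat => n%:R : R) by move=> _ B _.
  exact: measurableT_comp.
have mV t : measurable_fun setT (V t) by exact: measurable_funM.
have V0 : \forall t \near +oo, forall z, 0 <= V t z.
  near=> t; have t0 : 0 <= t by near: t; exact/nbhs_pinfty_ge/num_real.
  by move=> z; rewrite divr_ge0.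
have mL c : measurable_fun setT (fun z => c * Theta z).
  exact: measurable_funM.
(* The limit is realized on the space of [Theta], as the point of the curve with parameter Theta. *)
pose Lambda : {RV P' >-> R} := HB.pack (fun z => (1 - gamma)^-1 * Theta z)
  (isMeasurableFun.Build _ _ _ _ _ (mL (1 - gamma)^-1)).
pose Sigma : {RV P' >-> R} := HB.pack (fun z => mu * Theta z)
  (isMeasurableFun.Build _ _ _ _ _ (mL mu)).
pose Xi : {RV P' >-> R} := HB.pack (cst (1 : R) : T' -> R)
  (isMeasurableFun.Build _ _ _ _ _ (measurable_cst (1 : R))).
have laplace u v w : joint_laplace_transform P' Lambda Xi Sigma u v w =
    ((expR (- v))%:E *
     laplace_transform P' Theta (u / (1 - gamma) + w * mu))%E.
  exact: joint_laplace_curve.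
exists d', T', P', Lambda, Xi, Sigma; split; last 2 first.
- by move=> u v w _ _ _; exact: laplace.
- move=> Theta1 u v w _ _ _; rewrite laplace laplace_transform_one//.
  by rewrite -EFinM opprD expRD; congr (_%:E); ring.
apply: (@cvg_in_distribution_curve _ _ _ _ _ V) => // eps eps0.
pose delta := Num.min (1 / 2) (eps / 4).
have delta0 : 0 < delta by rewrite lt_min !divr_gt0.
have delta2 : delta <= 1 / 2 by rewrite ge_min lexx.
have delta4 : delta <= eps / 4 by rewrite ge_min lexx orbT.
have one_powR : 1 `^ alpha = 1 :> R by rewrite powR1.
have rp1 : (1 + delta) `^ (- alpha) < 1.
  rewrite powRN invf_lt1 ?powR_gt0//; last lra.
  rewrite -[ltLHS]one_powR; apply: gt0_ltr_powR; rewrite ?nnegrE//; lra.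
have rm1 : 1 < (1 - delta) `^ (- alpha).
  rewrite powRN invf_gt1 ?powR_gt0//; last lra.
  rewrite -[ltRHS]one_powR; apply: gt0_ltr_powR; rewrite ?nnegrE//; lra.
set rp := (1 + delta) `^ (- alpha) in rp1.
set rm := (1 - delta) `^ (- alpha) in rm1.
(* [eta] comes after [delta], since it must fit into the gaps between 1 and (1 + delta)^(-alpha), (1
   - delta)^(-alpha). The error 2 delta + 3 eta is paid half by delta <= eps/4, half by the last
   condition. *)
have [eta [eta0 eta1 etap etam etae]] : exists eta, [/\ 0 < eta, eta < 1,
    rp + 3 * eta <= 1, 1 + 3 * eta <= rm & eta * (6 + kappa) <= eps / 2].
  pose eta := Num.min (Num.min (1 / 2) (eps / 2 / (6 + kappa)))
    (Num.min ((1 - rp) / 3) ((rm - 1) / 3)).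
  have k60 : 0 < 6 + kappa by lra.
  have l1 : eta <= 1 / 2 by rewrite !ge_min lexx.
  have l2 : eta <= eps / 2 / (6 + kappa) by rewrite !ge_min lexx !orbT.
  have l3 : eta <= (1 - rp) / 3 by rewrite !ge_min lexx !orbT.
  have l4 : eta <= (rm - 1) / 3 by rewrite !ge_min lexx !orbT.
  exists eta; split; try lra; last by rewrite -ler_pdivlMr.
  by rewrite !lt_min !divr_gt0// subr_gt0.
have delta01 : 0 < delta < 1 by apply/andP; split; lra.
have e20 : 0 < eps / 2 by rewrite divr_gt0.
have [K K0 typ] := atypical_small indep tauE fin p01 W_gt0 alpha_gt1 tauW hW
  delta01 eta0 e20.
pose Typ t n z :=
  typical_sample tau h (p t) (W t) delta eta n (fun i => X i z).
(* The bound [eta^-1] provides 1 <= eta p n, the price of rounding [s]. *)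
have typ' : \forall t \near +oo, forall n, Num.max K eta^-1 <= p t * n%:R ->
    exists B, [/\ measurable B,
    sigma_algebra_of_family setT (fun i => X i : T -> R) B,
    (P B <= (eps / 2)%:E)%E & forall z, ~ B z -> Typ t n z].
  apply: filterS typ => t H n; rewrite ge_max => /andP[Kn _]; exact: H.
have exc := exceptional_event N_X_indep s_cvgy eps0 typ'.
have dp0 : 0 < 1 + delta by lra.
have dm0 : 0 < 1 - delta by lra.
near=> t.
have [D [mD PD HD]] : exists D, [/\ measurable D, (P D <= eps%:E)%E &
    forall z, ~ D z -> Num.max K eta^-1 <= p t * (N t z)%:R /\
      Typ t (N t z) z] by near: t.
exists D; split=> // z /HD[]; rewrite ge_max => /andP[_ etaN] typz.
have t0 : 0 < t by near: t; exact/nbhs_pinfty_gt/num_real.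
have pt01 : 0 < p t < 1 by near: t.
have pt0 : 0 < p t by case/andP: pt01.
have Wt0 : 0 < W t by near: t.
have pW1 : p t * W t <= eta by near: t; exact: (cvgr_le _ pW0).
have pWt0 : 0 < p t * W t by rewrite mulr_gt0.
have npe : 1 <= eta * (p t * (N t z)%:R) by rewrite -ler_pdivrMl// mulr1.
have taup : tau ((1 + delta) * W t) <= p t * (rp + eta).
  rewrite [leRHS]mulrC -ler_pdivrMr//; near: t.
  by apply: (cvgr_le _ (tauW _ dp0)); rewrite ltrDl.
have taum : p t * (rm - eta) <= tau ((1 - delta) * W t).
  rewrite [leLHS]mulrC -ler_pdivlMr//; near: t.
  by apply: (cvgr_ge _ (tauW _ dm0)); rewrite gtrDl oppr_lt0.
have h_up : h (W t) <= p t * W t * (kappa + eta).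
  rewrite [leRHS]mulrC -ler_pdivrMr//; near: t.
  by apply: (cvgr_le _ hW1); rewrite ltrDl.
have h_lo : p t * W t * (kappa - delta - eta) <= h ((1 + delta) * W t).
  rewrite [leLHS]mulrC -ler_pdivlMr//; near: t; apply: (cvgr_ge _ (hW _ dp0)).
  have := powR_1D_lower alpha_gt1 delta0; rewrite -(ler_pM2l kappa0).
  have -> : kappa * (1 - (alpha - 1) * delta) = kappa - delta.
    by rewrite /kappa; field; rewrite gt_eqF// subr_gt0.
  by lra.
have eta01 : 0 < eta < 1 by rewrite eta0.
have [L1 L2 L3] := typical_sample_order_stats typz (fun i => ltW (X_gt0 i z))
  pt01 Wt0 delta01 eta01 (ltW kappa0) npe pW1 etap etam taup taum h_up h_lo.
rewrite -/(s t z) -/(x z) h0E in L1 L2 L3.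
split=> /=.
- have -> : largest_sum (x z) (N t z) (s t z) / (t * p t * U (p t)^-1) -
      (1 - gamma)^-1 * V t z =
      (largest_sum (x z) (N t z) (s t z) -
       (1 + kappa) * ((N t z)%:R * (p t * W t))) / (t * p t * W t).
    by rewrite kE /V /W; field; rewrite !gt_eqF.
  have tpW : 0 < t * p t * W t by rewrite !mulr_gt0.
  rewrite normrM [X in _ * X]gtr0_norm ?invr_gt0// ler_pdivrMr//.
  apply: le_trans L1 _.
  have -> : eps * V t z * (t * p t * W t) = eps * ((N t z)%:R * (p t * W t)).
    by rewrite /V; field; rewrite gt_eqF.
  apply: ler_wpM2r; first by rewrite mulr_ge0// ltW.
  have := mulr_gt0 eta0 kappa0; lra.
- have -> : order_stat (x z) (N t z) (N t z - s t z) / U (p t)^-1 - 1 =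
      (order_stat (x z) (N t z) (N t z - s t z) - W t) / W t.
    by rewrite /W; field; rewrite gt_eqF.
  rewrite normrM [X in _ * X]gtr0_norm ?invr_gt0// ler_pdivrMr//.
  by apply: le_trans L2 _; rewrite ler_pM2r//; lra.
- have -> : smallest_sum (x z) (N t z) (s t z) / t - mu * V t z =
      (smallest_sum (x z) (N t z) (s t z) - mu * (N t z)%:R) / t.
    by rewrite /V; field; rewrite gt_eqF.
  rewrite normrM [X in _ * X]gtr0_norm ?invr_gt0// ler_pdivrMr//.
  apply: le_trans L3 _.
  have -> : eps * V t z * t = eps * (N t z)%:R.
    by rewrite /V; field; rewrite gt_eqF.
  by apply: ler_wpM2r => //; lra.
Unshelve. all: by end_near. Qed.
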